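(* Let $\Phi=(\Phi^{(j)})_{j\in\mathbb{N}}$ be a conformal NIFS on $(U,X)$, with $X$ connected, satisfying the Strong Separation Condition. Suppose that along some subsequence $(j_n)_{n\in\mathbb{N}}$ of the positive integers we have $2\le\#\Phi^{(j_n)}<\infty$ for all $n\in\mathbb{N}$. Define, for each $n\in\mathbb{N}$, $$b_{j_n}=\min\{\mathrm{dist}(\varphi^{(j_n)}_i(X),\partial X): i\in I^{(j_n)}\},$$ $$\delta_{j_n}=\min\{\mathrm{dist}(\varphi^{(j_n)}_a(X),\varphi^{(j_n)}_b(X)): a,b\in I^{(j_n)},\ a\ne b\},$$ $$\eta_{j_n}=\max\{\mathrm{diam}(\varphi^{(j_n)}_i(X)): i\in I^{(j_n)}\}.$$ Suppose that for some $c>1$ we have $\delta_{j_n}\le c\,b_{j_n}$ for all $n\in\mathbb{N}$, and suppose further that $\delta_{j_n}/\eta_{j_n}\to\infty$ as $n\to\infty$. Then $J=J(\Phi)$ satisfies $J=\pi_\Phi(I^\infty)$ and $J$ is pointwise thin (and thus hereditarily non uniformly perfect when $J$ is compact).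
   Context: NIFS. Let $U\subseteq\mathbb{C}$ be non-empty, open and connected and let $X\subset U$ be compact. A non-autonomous iterated function system (NIFS) $\Phi$ on $(U,X)$ is a sequence $\Phi^{(1)},\Phi^{(2)},\dots$, where each $\Phi^{(j)}=(\varphi^{(j)}_i:U\to X)_{i\in I^{(j)}}$ is a collection of non-constant functions indexed by a non-empty set $I^{(j)}$ (of arbitrary cardinality), such that there exist $0<s<1$ and a metric $d$ on $U$, inducing the Euclidean topology on $X$, with $d(\varphi(z),\varphi(w))\le s\,d(z,w)$ for all $z,w\in X$ and all $\varphi\in\bigcup_j\Phi^{(j)}$. The NIFS is conformal if all its maps are analytic and one-to-one on $U$. It satisfies the Strong Separation Condition if $\varphi^{(j)}_a(X)\cap\varphi^{(j)}_b(X)=\emptyset$ for each $j\in\mathbb{N}$ and all distinct $a,b\in I^{(j)}$. Limit set and projection map. Let $I^k=\prod_{j=1}^k I^{(j)}$ and $I^\infty=\prod_{j=1}^\infty I^{(j)}$. For $\omega=\omega_1\cdots\omega_k\in I^k$ put $\varphi_\omega=\varphi^{(1)}_{\omega_1}\circ\cdots\circ\varphi^{(k)}_{\omega_k}$, and let $X_k=\bigcup_{\omega\in I^k}\varphi_\omega(X)$. The limit set is $J(\Phi)=\bigcap_{k=1}^\infty X_k$. The projection map $\pi_\Phi:I^\infty\to J(\Phi)$ sends $\omega\in I^\infty$ to the unique point of $\bigcap_{n=1}^\infty\varphi_{\omega_1\cdots\omega_n}(X)$. Annuli and thinness. A conformal annulus is a doubly connected domain $A\subset\mathbb{C}$ that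 can be mapped conformally onto a round annulus $\{z:r<|z-w|<R\}$ with $0<r<R<\infty$; its modulus is $\mathrm{mod}\,A=\log(R/r)$. It separates a set $F\subset\mathbb{C}$ if $F\cap A=\emptyset$ and $F$ meets both components of $\mathbb{C}\setminus A$. A compact set $F\subset\mathbb{C}$ with at least two points is uniformly perfect if there is a uniform upper bound on the moduli of all conformal annuli which separate $F$. A compact set is hereditarily non uniformly perfect (HNUP) if no subset of it is uniformly perfect. A set $E\subset\mathbb{C}$ is pointwise thin at $z\in E$ if there is a sequence of conformal annuli $A_n$, each of which separates $E$ and has $z$ in the bounded component of its complement, such that $\mathrm{mod}\,A_n\to+\infty$ while the Euclidean diameter of $A_n$ tends to $0$; $E$ is pointwise thin if it is pointwise thin at each of its points. The quantities $\mathrm{dist}$ and $\mathrm{diam}$ are Euclidean. *)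

(* Defs.v *)
From HB Require Import structures.
From mathcomp Require Import all_boot all_order all_algebra.
From mathcomp Require Import complex.
From mathcomp Require Import all_classical all_reals all_analysis.

Set Implicit Arguments.
Unset Strict Implicit.
Unset Printing Implicit Defensive.

Import Order.TTheory GRing.Theory Num.Theory numFieldNormedType.Exports.

Local Open Scope classical_set_scope.
Local Open Scope ring_scope.

(* The Euclidean topology on the complex numbers: R[i] as a normed space over
   itself. In particular [derivable f z 1], for f : R[i] -> R[i], is complex
   differentiability. *)
HB.instance Definition _ (R : rcfType) := NormedModule.copy R[i] R[i]^o.

Section PlaneGeometry.
Context {R : realType}.
Implicit Types (A B E F : set R[i]) (f : R[i] -> R[i]) (z w : R[i]).

(* The norm of R[i] takes its (real, nonnegative) values in R[i]. *)
Definition cdist z w : R := complex.Re `|z - w|.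

Definition dist A B : R := inf [set cdist z w | z in A & w in B].

(* Extended-real valued, so that unbounded sets have diameter +oo. *)
Definition diam A : \bar R := ereal_sup [set (cdist z w)%:E | z in A & w in A].

Definition boundary A : set R[i] := closure A `\` interior A.

Definition analytic_on A f : Prop := forall z, A z -> derivable f z 1.

Definition conformal_on A f : Prop := analytic_on A f /\ set_inj A f.

Definition components A : set (set R[i]) :=
  [set connected_component A z | z in A].

Definition doubly_connected_domain A : Prop :=
  [/\ A !=set0, open A, connected A & (components (~` A) #= `I_2)%card].

Definition round_annulus w (r s : R) : set R[i] :=
  [set z | r < cdist z w < s].

(* [has_modulus A m] reads: A is a conformal annulus and mod A = m. The modulus
   is kept as a relation; it is single-valued because the ratio s / r is a
   conformal invariant. *)
Definition has_modulus A (m : R) : Prop :=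
  doubly_connected_domain A /\
  exists (w : R[i]) (r s : R) (f : R[i] -> R[i]),
    [/\ 0 < r < s, conformal_on A f, f @` A = round_annulus w r s
      & m = ln (s / r)].

Definition separates A F : Prop :=
  F `&` A = set0 /\ forall K, components (~` A) K -> F `&` K !=set0.

Definition uniformly_perfect F : Prop :=
  [/\ compact F,
      exists z w, [/\ F z, F w & z <> w]
    & exists M : R, forall A m, has_modulus A m -> separates A F -> m <= M].

Definition hnup E : Prop :=
  compact E /\ forall F, F `<=` E -> ~ uniformly_perfect F.

Definition pointwise_thin_at E z : Prop :=
  exists (A : nat -> set R[i]) (m : nat -> R),
    [/\ forall n, has_modulus (A n) (m n) /\ separates (A n) E,
        forall n, (~` A n) z /\ bounded_set (connected_component (~` A n) z),
        m @ \oo --> +oo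
      & (fun n => diam (A n)) @ \oo --> 0%E].

Definition pointwise_thin E : Prop := forall z, E z -> pointwise_thin_at E z.

Definition is_metric_on A (d : R[i] -> R[i] -> R) : Prop :=
  [/\ forall z w, A z -> A w -> 0 <= d z w,
      forall z w, A z -> A w -> d z w = 0 <-> z = w,
      forall z w, A z -> A w -> d z w = d w z
    & forall z w v, A z -> A w -> A v -> d z v <= d z w + d w v].

(* The d-open subsets of A are exactly its relatively (Euclidean) open ones. *)
Definition induces_euclidean_topology A (d : R[i] -> R[i] -> R) : Prop :=
  forall V, V `<=` A ->
    (exists2 O : set R[i], open O & V = A `&` O) <->
    (forall z, V z -> exists2 e : R, 0 < e &
       forall w, A w -> d z w < e -> V w).

End PlaneGeometry.

(* A function U -> X is a function R[i] -> R[i] mapping U into X; its values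
   off U play no role. Time steps are numbered from 0, so that [idx j] is
   I^(j+1). *)
Record nifs (R : realType) (U X : set R[i]) := Nifs {
  idx : nat -> Type;
  nmap : forall j, idx j -> R[i] -> R[i];
  nifs_dom : [/\ U !=set0, open U & connected U];
  nifs_compact : compact X;
  nifs_sub : X `<=` U;
  nifs_idx : forall j, inhabited (idx j);
  nifs_maps : forall j (i : idx j) z, U z -> X (nmap i z);
  nifs_nonconstant : forall j (i : idx j),
    exists z w, [/\ U z, U w & nmap i z <> nmap i w];
  nifs_contract : exists (s : R) (d : R[i] -> R[i] -> R),
    [/\ 0 < s < 1, is_metric_on U d, induces_euclidean_topology X d
      & forall j (i : idx j) z w, X z -> X w ->
          d (nmap i z) (nmap i w) <= s * d z w]
}.

Section Nifs.
Context {R : realType} {U X : set R[i]}.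
Variable Phi : nifs U X.

Definition conformal_nifs : Prop :=
  forall j (i : idx Phi j), conformal_on U (nmap i).

Definition strong_separation : Prop :=
  forall j (a b : idx Phi j), a <> b -> nmap a @` X `&` nmap b @` X = set0.

(* The finite product I^k. *)
Fixpoint word (k : nat) : Type :=
  if k is k'.+1 then (word k' * idx Phi k')%type else unit.

Fixpoint word_map (k : nat) : word k -> R[i] -> R[i] :=
  match k with
  | 0%N => fun _ => id
  | k'.+1 => fun w => word_map w.1 \o nmap w.2
  end.

Definition infinite_word : Type := forall j, idx Phi j.

Fixpoint word_prefix (omega : infinite_word) (k : nat) : word k :=
  match k with
  | 0%N => tt
  | k'.+1 => (word_prefix omega k', omega k')
  end.

Definition level_set (k : nat) : set R[i] :=
  \bigcup_(w in [set: word k]) (word_map w @` X).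

Definition limit_set : set R[i] :=
  \bigcap_(k in [set k | (0 < k)%N]) level_set k.

Definition projection (omega : infinite_word) : R[i] :=
  get [set z | \bigcap_(n in [set n | (0 < n)%N])
                 (word_map (word_prefix omega n) @` X) = [set z]].

(* The minima and the maximum below are only used when 2 <= #I^(j) < oo; they
   are then attained, hence equal to inf and sup. *)
Definition bdist (j : nat) : R :=
  inf [set dist (nmap i @` X) (boundary X) | i in [set: idx Phi j]].

Definition gap (j : nat) : R :=
  inf [set t | exists a b : idx Phi j,
                 a <> b /\ t = dist (nmap a @` X) (nmap b @` X)].

Definition maxdiam (j : nat) : R :=
  sup [set fine (diam (nmap i @` X)) | i in [set: idx Phi j]].

End Nifs.

Arguments projection {R U X} Phi omega.

(* Main.v *)
Require Import Defs.
From HB Require Import structures.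
From mathcomp Require Import all_boot all_order all_algebra.
From mathcomp Require Import complex.
From mathcomp Require Import all_classical all_reals all_analysis.
From mathcomp Require Import ring lra.

Set Implicit Arguments.
Unset Strict Implicit.
Unset Printing Implicit Defensive.

Import Order.TTheory GRing.Theory Num.Theory numFieldNormedType.Exports.

Local Open Scope classical_set_scope.
Local Open Scope ring_scope.

(** Why the theorem is true.  A point z of the limit set is coded by an
    infinite word omega, and is the intersection of the nested pieces
    word_map (word_prefix omega k) @` X, whose diameters shrink to 0.  Let j be
    one of the good levels, f the word map of the prefix of length j, and a the
    next letter.  Inside X, the set nmap a @` X has diameter at most maxdiam j,
    while the other sets nmap b @` X and the boundary of X stay at distance at
    least gap j / c from it.  So the round annulus with radii r = maxdiam j and
    s = gap j / (2 c) around a point of nmap a @` X lies in X and separates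
    these sets.  Its image A under f is a conformal annulus that lies in the
    piece of level j and separates the limit set, because the limit set inside
    that piece is contained in the sets f @` (nmap b @` X).  Its modulus
    ln (s / r) is unbounded as gap / maxdiam tends to infinity, and its
    diameter tends to 0.  This is pointwise thinness.  If F is a subset of the
    limit set with two points z and w, then the annuli around z eventually have
    w in the outer component of their complement, so they separate F too, and F
    is not uniformly perfect.

    That A is a conformal annulus needs two facts on injective functions which
    are complex differentiable on an open set, with no continuity assumed of
    the derivative: they are open, and their inverses are complex
    differentiable (univalent_image_open, inverse_cdiff).  Both rest on
    Goursat's theorem for rectangles (goursat), Cauchy's formula
    (cauchy_formula), the maximum principle for rectangles (maximum_principle)
    and the removal of singularities (removable_singularity).  Openness follows
    from the maximum principle for 1 / (f - w).  For the inverse, the critical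
    points of f are isolated (critical_isolated), so the inverse is continuous
    and is differentiable away from isolated points, and these are removable.
    The complement of A has exactly two components because the complement of
    the image of an open disc is connected (outer_connected).

    Complex differentiability is used in Caratheodory's form: f is
    differentiable at p when f u = f p + (u - p) * q u for some q that is
    continuous at p.  Products, compositions and difference quotients are then
    handled by algebra on q. *)

(** * The modulus and the topology of the plane *)

Section ComplexModulus.
Context {R : realType}.
Implicit Types (z w u p : R[i]) (f g : R[i] -> R[i]) (A B : set R[i]).

(** The norm of R[i] takes values in R[i]; this is the same modulus as a real
    number. *)
Definition cabs z : R := complex.Re `|z|.

Lemma cdistE z w : cdist z w = cabs (z - w). Proof. by []. Qed.

Lemma normE z : `|z| = (cabs z)%:C%C.
Proof. by rewrite /cabs normc_def. Qed.

Lemma cabsE z : cabs z = Num.sqrt (complex.Re z ^+ 2 + complex.Im z ^+ 2).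
Proof. by rewrite /cabs normc_def. Qed.

Lemma cabs_ge0 z : 0 <= cabs z.
Proof. by rewrite cabsE sqrtr_ge0. Qed.

Lemma cabsM z w : cabs (z * w) = cabs z * cabs w.
Proof. by apply: complexI; rewrite -normE normrM !normE rmorphM. Qed.

Lemma cabsX z n : cabs (z ^+ n) = cabs z ^+ n.
Proof. by apply: complexI; rewrite -normE normrX !normE rmorphXn. Qed.

Lemma cabsV z : cabs z^-1 = (cabs z)^-1.
Proof. by apply: complexI; rewrite -normE normfV !normE fmorphV. Qed.

Lemma cabsN z : cabs (- z) = cabs z.
Proof. by apply: complexI; rewrite -!normE normrN. Qed.

Lemma cabsC z w : cabs (z - w) = cabs (w - z).
Proof. by rewrite -cabsN opprB. Qed.

Lemma cabsD z w : cabs (z + w) <= cabs z + cabs w.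
Proof. by rewrite -lecR rmorphD -!normE ler_normD. Qed.

Lemma cabs_triangle u z w : cabs (z - w) <= cabs (z - u) + cabs (u - w).
Proof. by rewrite (_ : z - w = (z - u) + (u - w)) ?cabsD// addrA subrK. Qed.

Lemma cabs0 : cabs 0 = 0.
Proof. by apply: complexI; rewrite -normE normr0. Qed.

Lemma cabs_eq0 z : (cabs z == 0) = (z == 0).
Proof. by rewrite -(inj_eq (@complexI _)) -normE normr_eq0. Qed.

Lemma cabs_gt0 z : (0 < cabs z) = (z != 0).
Proof. by rewrite lt_def cabs_ge0 cabs_eq0 andbT. Qed.

Lemma cabs_real (x : R) : cabs x%:C%C = `|x|.
Proof. by rewrite cabsE/= expr0n addr0 sqrtr_sqr. Qed.

Lemma cabs_nat n : cabs n%:R = n%:R.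
Proof. by rewrite -(rmorph_nat (real_complex R)) cabs_real normr_nat. Qed.

Lemma Re_le_cabs z : `|complex.Re z| <= cabs z.
Proof. by rewrite cabsE -sqrtr_sqr ler_wsqrtr// lerDl sqr_ge0. Qed.

Lemma Im_le_cabs z : `|complex.Im z| <= cabs z.
Proof. by rewrite cabsE -sqrtr_sqr ler_wsqrtr// lerDr sqr_ge0. Qed.

Lemma cabs_le_ReIm z : cabs z <= `|complex.Re z| + `|complex.Im z|.
Proof.
rewrite cabsE -(ger0_norm (addr_ge0 (normr_ge0 _) (normr_ge0 _))) -sqrtr_sqr.
rewrite ler_wsqrtr// sqrrD !real_normK ?num_real//.
by rewrite -addrA lerD2l lerDr mulrn_wge0// mulr_ge0.
Qed.

Lemma cReD z w : complex.Re (z + w) = complex.Re z + complex.Re w.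
Proof. by case: z; case: w. Qed.

Lemma cImD z w : complex.Im (z + w) = complex.Im z + complex.Im w.
Proof. by case: z; case: w. Qed.

Lemma cReB z w : complex.Re (z - w) = complex.Re z - complex.Re w.
Proof. by case: z; case: w. Qed.

Lemma cImB z w : complex.Im (z - w) = complex.Im z - complex.Im w.
Proof. by case: z; case: w. Qed.

Lemma cReM z w : complex.Re (z * w) =
  complex.Re z * complex.Re w - complex.Im z * complex.Im w.
Proof. by case: z; case: w. Qed.

Lemma cImM z w : complex.Im (z * w) =
  complex.Re z * complex.Im w + complex.Im z * complex.Re w.
Proof. by case: z => a b; case: w => c d. Qed.

Lemma complex_eqP z w :
  complex.Re z = complex.Re w -> complex.Im z = complex.Im w -> z = w.
Proof. by case: z; case: w => a b c d /= -> ->. Qed.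

Lemma nbhs_cabs p (P : R[i] -> Prop) :
  (\forall u \near p, P u) <->
  exists2 e : R, 0 < e & forall u, cabs (u - p) < e -> P u.
Proof.
split=> [/nbhs_ballP[e /= e0 eP]|[e e0 eP]].
  exists (complex.Re e); first by move: e0; rewrite ltcE => /andP[_].
  move=> u up; apply: eP; rewrite -ball_normE /ball_/= normE cabsC.
  move: e0; rewrite !ltcE/= => /andP[/eqP -> _]; rewrite eqxx/=.
  by move: up.
apply/nbhs_ballP; exists (e%:C)%C => /=; first by rewrite ltcR.
by move=> u; rewrite -ball_normE /ball_/= normE ltcR cabsC; exact: eP.
Qed.

Lemma cvg_cabs {T : Type} (F : set_system T) {FF : Filter F} (f : T -> R[i]) z :
  f @ F --> z <-> forall e : R, 0 < e -> \forall t \near F, cabs (f t - z) < e.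
Proof.
split=> [fz e e0|fz].
  have /cvgrPdist_lt/(_ (e%:C)%C) := fz.
  rewrite ltcR => /(_ e0); apply: filterS => t.
  by rewrite normE ltcR cabsC.
apply/cvgrPdist_lt => e; rewrite ltcE => /andP[/= /eqP e1 e2].
apply: filterS (fz _ e2) => t.
by rewrite normE ltcE/= e1 eqxx/= cabsC.
Qed.

Lemma open_cabs A : open A <->
  forall p, A p -> exists2 e : R, 0 < e & forall u, cabs (u - p) < e -> A u.
Proof.
rewrite openE; split=> Ao p Ap; first exact/nbhs_cabs/Ao.
exact/nbhs_cabs/Ao.
Qed.

Lemma continuous_real_cabs (g : R[i] -> R) p :
  (forall e : R, 0 < e -> exists2 d : R, 0 < d &
     forall u, cabs (u - p) < d -> `|g p - g u| < e) -> g @ p --> g p.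
Proof.
move=> gp; apply/(@cvgrPdist_lt _ _ _ (nbhs p) _ g (g p)) => e e0.
exact/nbhs_cabs/gp.
Qed.

Lemma Re_continuous : continuous (@complex.Re R : R[i] -> R).
Proof.
move=> p; apply: continuous_real_cabs => e e0; exists e => // u up.
by rewrite -cReB (le_lt_trans (Re_le_cabs _))// cabsC.
Qed.

Lemma Im_continuous : continuous (@complex.Im R : R[i] -> R).
Proof.
move=> p; apply: continuous_real_cabs => e e0; exists e => // u up.
by rewrite -cImB (le_lt_trans (Im_le_cabs _))// cabsC.
Qed.

Lemma cabs_continuous : continuous (cabs : R[i] -> R).
Proof.
move=> p; apply: continuous_real_cabs => e e0; exists e => // u up.
apply: le_lt_trans up; rewrite ler_norml; apply/andP; split.
  by have := cabsD (u - p) p; rewrite subrK; lra.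
by have := cabsD (p - u) u; rewrite subrK (cabsC p); lra.
Qed.

Lemma cvg_ReIm {T : Type} (F : set_system T) {FF : Filter F} (g h : T -> R)
    (a b : R) : g @ F --> a -> h @ F --> b ->
  (fun t => (g t +i* h t)%C) @ F --> (a +i* b)%C.
Proof.
move=> ga hb; apply/cvg_cabs => e e0.
have e2 : 0 < e / 2 by rewrite divr_gt0.
have /cvgrPdist_lt/(_ _ e2) Ha := ga; have /cvgrPdist_lt/(_ _ e2) Hb := hb.
apply: filterS2 Ha Hb => t ta tb.
apply: le_lt_trans (cabs_le_ReIm _) _; rewrite cReB cImB/= (distrC (g t)).
by rewrite (distrC (h t)); lra.
Qed.

(** Continuity at a point, as an inductive predicate so that it stays folded
    during unification. *)
Variant cont f p : Prop := Cont of f @ p --> f p.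

Lemma cont_cvg f p : cont f p -> f @ p --> f p.
Proof. by case. Qed.

Lemma contP f p : cont f p <-> forall e : R, 0 < e ->
    exists2 d : R, 0 < d & forall u, cabs (u - p) < d -> cabs (f u - f p) < e.
Proof.
have E := @cvg_cabs _ (nbhs p) _ f (f p).
split=> [[/E fp] e e0|fp]; first exact/nbhs_cabs/fp.
by split; apply/E => e e0; apply/nbhs_cabs/fp.
Qed.

Lemma cont_cst c p : cont (fun=> c) p.
Proof. by split; exact: (@cvg_cst _ c _ (nbhs p)). Qed.

Lemma cont_id p : cont id p.
Proof. by split; exact: (@cvg_id _ (nbhs p)). Qed.

Lemma contD f g p : cont f p -> cont g p -> cont (fun u => f u + g u) p.
Proof. by case=> fp [gp]; split;
  exact: (@cvgD _ R[i] _ (nbhs p) _ f g _ _ fp gp). Qed.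

Lemma contB f g p : cont f p -> cont g p -> cont (fun u => f u - g u) p.
Proof. by case=> fp [gp]; split;
  exact: (@cvgB _ R[i] _ (nbhs p) _ f g _ _ fp gp). Qed.

Lemma cont_subl w p : cont (fun u => u - w) p.
Proof. exact: (contB (f := id) (g := fun=> w) (cont_id p) (cont_cst w p)). Qed.

Lemma contN f p : cont f p -> cont (fun u => - f u) p.
Proof. by case=> fp; split; exact: (@cvgN _ R[i] _ (nbhs p) _ f _ fp). Qed.

Lemma contM f g p : cont f p -> cont g p -> cont (fun u => f u * g u) p.
Proof. by case=> fp [gp]; split;
  exact: (@cvgM _ _ (nbhs p) _ f g _ _ fp gp). Qed.

Lemma contV f p : f p != 0 -> cont f p -> cont (fun u => (f u)^-1) p.
Proof. by move=> fp0 [fp]; split; exact: (@cvgV _ _ (nbhs p) _ f _ fp0 fp). Qed.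

Lemma cont_comp f g p : cont f p -> cont g (f p) -> cont (g \o f) p.
Proof.
case=> fp [gp]; apply: Cont.
by apply: (@cvg_comp _ _ _ f g (nbhs p) (nbhs (f p))); [exact: fp|exact: gp].
Qed.

Lemma compact_rect (a b c d : R) :
  compact [set z : R[i] | a <= complex.Re z <= b /\ c <= complex.Im z <= d].
Proof.
have -> : [set z : R[i] | a <= complex.Re z <= b /\ c <= complex.Im z <= d] =
  (fun t : R * R => (t.1 +i* t.2)%C) @` (`[a, b] `*` `[c, d]).
  rewrite eqEsubset; split=> [[x y]/= [xab ycd]|_ [[x y]/= [xab ycd] <-]].
    by exists (x, y); [split; rewrite /= in_itv|].
  by move: xab ycd; rewrite !in_itv.
apply: continuous_compact; last by apply: compact_setX; exact: segment_compact.
apply: continuous_subspaceT => t.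
by apply: cvg_ReIm; [exact: cvg_fst|exact: cvg_snd].
Qed.

Lemma closed_disc_compact p (r : R) : compact [set z | cabs (z - p) <= r].
Proof.
pose a := complex.Re p; pose b := complex.Im p.
apply: (subclosed_compact _ (@compact_rect (a - r) (a + r) (b - r) (b + r))).
  have -> : [set z | cabs (z - p) <= r] =
     (fun z => cabs (z - p)) @^-1` [set x : R | x <= r] by [].
  apply: closed_comp; last exact: closed_le.
  move=> z _; apply: (@continuous_comp _ _ _ (fun z => z - p) cabs).
    exact/cont_cvg/cont_subl.
  exact: cabs_continuous.
move=> z /= zr; have := le_trans (Re_le_cabs _) zr.
have := le_trans (Im_le_cabs _) zr.
by rewrite cReB cImB !ler_distl => -> ->.
Qed.

Lemma C_hausdorff : hausdorff_space R[i].
Proof. exact: norm_hausdorff. Qed.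

Lemma compact_bound A : compact A -> exists2 M : R, 0 < M &
  forall z, A z -> cabs z <= M.
Proof.
move=> cA; have [->|A0] := eqVneq A set0; first by exists 1.
have [||c _ cM] := @compact_EVT_max _ R cabs A _ cA; first exact/set0P.
  by apply: continuous_subspaceT => z; exact: cabs_continuous.
exists (cabs c + 1); first by have := cabs_ge0 c; lra.
by move=> z /mem_set/cM; lra.
Qed.

Lemma nested_compact (K : nat -> set R[i]) :
  (forall n, compact (K n)) -> (forall n, K n !=set0) ->
  (forall n, K n.+1 `<=` K n) -> exists z, forall n, K n z.
Proof.
move=> Kc K0 KS.
have Kle m n : (m <= n)%N -> K n `<=` K m.
  by move=> /subnK <-; elim: (n - m)%N => [|k IH] //= z /KS; exact: IH.
have := Kc 0%N; rewrite compact_In0 => /(_ nat setT K)[].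
- exists K; first by move=> n _; apply: compact_closed => //;
  exact: C_hausdorff.
  by move=> n _; apply/esym/setIidPr/Kle.
- move=> D _; have [z Kz] := K0 (\max_(i <- finmap.enum_fset D) i)%N.
  exists z => n /= nD; apply: Kle Kz.
  by apply: (leq_bigmax_seq (F := id)).
- by move=> z Kz; exists z => n; exact: Kz.
Qed.

(** Otherwise the sets K n minus O are nested, compact and non-empty. *)
Lemma nested_compact_sub (K : nat -> set R[i]) (O : set R[i]) :
  (forall n, compact (K n)) -> (forall n, K n.+1 `<=` K n) -> open O ->
  (forall z, (forall n, K n z) -> O z) -> exists n, K n `<=` O.
Proof.
move=> Kc KS Oo KO; apply: contrapT => /forallNP H.
have [|||z Kz] := @nested_compact (fun n => K n `&` ~` O).
- move=> n; apply: (subclosed_compact _ (Kc n)) => //.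
  apply: closedI; last exact: open_closedC.
  by apply: compact_closed => //; exact: C_hausdorff.
- move=> n; apply: contrapT => /set0P/negP/negPn/eqP nO; apply: (H n) => z Kz.
  apply: contrapT => nOz; suff : (set0 : set R[i]) z by [].
  by rewrite -nO.
- by move=> n z [/KS].
- by have [_] := Kz 0%N; apply; apply: KO => n; have [] := Kz n.
Qed.

End ComplexModulus.

(** * Integrals along segments and around rectangles *)

Section PathIntegral.
Context {R : realType}.
Implicit Types (a b c d m t M : R) (g h : R -> R[i]) (k l z : R[i]).
Local Notation mu := (@lebesgue_measure R).
Local Notation Re := (@complex.Re R).
Local Notation Im := (@complex.Im R).

Definition path_cont a b g : Prop := forall t, a <= t <= b ->
  ((fun x => Re (g x)) @ t --> Re (g t)) /\
  ((fun x => Im (g x)) @ t --> Im (g t)).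

Definition cint a b g : R[i] :=
  ((\int[mu]_(t in `[a, b]) Re (g t)) +i* (\int[mu]_(t in `[a, b]) Im (g t)))%C.

Lemma continuous_itv_integrable a b (f : R -> R) :
  (forall t, a <= t <= b -> f @ t --> f t) ->
  mu.-integrable `[a, b] (EFin \o f).
Proof.
move=> fc; apply: continuous_compact_integrable; first exact: segment_compact.
by apply: continuous_in_subspaceT => t; rewrite inE/= in_itv => /fc.
Qed.

Lemma path_cont_Re a b g : path_cont a b g ->
  mu.-integrable `[a, b] (EFin \o (fun t => Re (g t))).
Proof. by move=> gc; apply: continuous_itv_integrable => t /gc[]. Qed.

Lemma path_cont_Im a b g : path_cont a b g ->
  mu.-integrable `[a, b] (EFin \o (fun t => Im (g t))).
Proof. by move=> gc; apply: continuous_itv_integrable => t /gc[]. Qed.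

Lemma path_contD a b g h : path_cont a b g -> path_cont a b h ->
  path_cont a b (fun t => g t + h t).
Proof.
move=> gc hc t tab; have [? ?] := gc t tab; have [? ?] := hc t tab.
split; [rewrite cReD (funext (fun x => cReD (g x) (h x)))|
        rewrite cImD (funext (fun x => cImD (g x) (h x)))]; exact: cvgD.
Qed.

Lemma path_contM a b g h : path_cont a b g -> path_cont a b h ->
  path_cont a b (fun t => g t * h t).
Proof.
move=> gc hc t tab; have [? ?] := gc t tab; have [? ?] := hc t tab.
split.
  rewrite cReM (funext (fun x => cReM (g x) (h x))).
  by apply: cvgB; exact: cvgM.
rewrite cImM (funext (fun x => cImM (g x) (h x))).
by apply: cvgD; exact: cvgM.
Qed.

Lemma path_cont_cst a b k : path_cont a b (fun=> k).
Proof. by move=> t _; split; exact: cvg_cst. Qed.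

Lemma path_contB a b g h : path_cont a b g -> path_cont a b h ->
  path_cont a b (fun t => g t - h t).
Proof.
move=> gc hc t tab; have [? ?] := gc t tab; have [? ?] := hc t tab.
split; [rewrite cReB (funext (fun x => cReB (g x) (h x)))|
        rewrite cImB (funext (fun x => cImB (g x) (h x)))]; exact: cvgB.
Qed.

Lemma eq_cint a b g h : (forall t, a <= t <= b -> g t = h t) ->
  cint a b g = cint a b h.
Proof.
by move=> gh; congr (_ +i* _)%C; apply: eq_Rintegral => t;
  rewrite inE/= in_itv/= => /gh ->.
Qed.

Lemma cintD a b g h : path_cont a b g -> path_cont a b h ->
  cint a b (fun t => g t + h t) = cint a b g + cint a b h.
Proof.
move=> gc hc; rewrite /cint; apply: complex_eqP => /=.
  under eq_Rintegral do rewrite cReD.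
  by rewrite RintegralD//; exact: path_cont_Re.
under eq_Rintegral do rewrite cImD.
by rewrite RintegralD//; exact: path_cont_Im.
Qed.

Lemma cintZ a b k g : path_cont a b g ->
  cint a b (fun t => k * g t) = k * cint a b g.
Proof.
move=> gc; rewrite /cint; apply: complex_eqP; rewrite ?cReM ?cImM /=.
  under eq_Rintegral do rewrite cReM.
  have Ra := path_cont_Re gc; have Ia := path_cont_Im gc.
  rewrite RintegralB//; first by rewrite !RintegralZl.
    by apply: continuous_itv_integrable => t /gc[? ?]; apply: cvgM => //;
      exact: cvg_cst.
  by apply: continuous_itv_integrable => t /gc[? ?]; apply: cvgM => //;
    exact: cvg_cst.
under eq_Rintegral do rewrite cImM.
have Ra := path_cont_Re gc; have Ia := path_cont_Im gc.
rewrite RintegralD//; first by rewrite !RintegralZl.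
  by apply: continuous_itv_integrable => t /gc[? ?]; apply: cvgM => //;
    exact: cvg_cst.
by apply: continuous_itv_integrable => t /gc[? ?]; apply: cvgM => //;
  exact: cvg_cst.
Qed.

Lemma cintB a b g h : path_cont a b g -> path_cont a b h ->
  cint a b (fun t => g t - h t) = cint a b g - cint a b h.
Proof.
move=> gc hc; rewrite -mulN1r -cintZ// -cintD//.
  by apply: eq_cint => t _; rewrite mulN1r.
by apply: path_contM => //; exact: path_cont_cst.
Qed.

Lemma Rintegral_itv_cst a b (x : R) : a <= b ->
  \int[mu]_(t in `[a, b]) x = x * (b - a).
Proof.
move=> ab; rewrite Rintegral_cst//= lebesgue_measure_itv/= lte_fin.
by case: ltgtP ab => // -> _; rewrite subrr.
Qed.

Lemma cint_cst a b k : a <= b -> cint a b (fun=> k) = k * (b - a)%:C%C.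
Proof.
move=> ab; rewrite /cint !Rintegral_itv_cst//.
by apply: complex_eqP; rewrite ?cReM ?cImM/=; lra.
Qed.

Lemma cint_split a m b g : a <= m <= b -> path_cont a b g ->
  cint a b g = cint a m g + cint m b g.
Proof.
move=> /andP[am mb] gc.
have H (f : R -> R) : (forall t, a <= t <= b -> f @ t --> f t) ->
    \int[mu]_(t in `[a, b]) f t =
    \int[mu]_(t in `[a, m]) f t + \int[mu]_(t in `[m, b]) f t.
  move=> fc; have fi := continuous_itv_integrable fc.
  have := Rintegral_itvB fi; move=> /(_ m); rewrite !bnd_simp => /(_ am mb) E.
  rewrite -(@Rintegral_itv_obnd_cbnd _ m); first by rewrite -E addrC subrK.
  by apply: integrableS fi => // t; rewrite /= !in_itv/= => /andP[/ltW mt ->];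
    rewrite (le_trans am mt).
apply: complex_eqP; rewrite ?cReD ?cImD/=; apply: H => t /gc[]//.
Qed.

(** The factor 2 comes from bounding the real and imaginary parts apart; all
    later uses are insensitive to it. *)
Lemma cint_bound a b g M : a <= b -> path_cont a b g ->
  (forall t, a <= t <= b -> cabs (g t) <= M) ->
  cabs (cint a b g) <= 2 * M * (b - a).
Proof.
move=> ab gc gM.
have H (f : R -> R) : (forall t, a <= t <= b -> f @ t --> f t) ->
    (forall t, a <= t <= b -> `|f t| <= M) ->
    `|\int[mu]_(t in `[a, b]) f t| <= M * (b - a).
  move=> fc fM; have fi := continuous_itv_integrable fc.
  apply: le_trans (le_normr_Rintegral _ _) _ => //.
  rewrite -Rintegral_itv_cst//; apply: le_Rintegral => //.
  - apply: continuous_itv_integrable => t /fc ft.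
    exact: (@cvg_norm _ R^o _ (nbhs t) _ f (f t)).
  - by apply: continuous_itv_integrable => t _; exact: cvg_cst.
apply: le_trans (cabs_le_ReIm _) _ => /=.
rewrite (_ : 2 * M * _ = M * (b - a) + M * (b - a)); last by lra.
apply: lerD; apply: H => t tab; try by have [] := gc t tab.
  exact: le_trans (Re_le_cabs _) (gM _ tab).
exact: le_trans (Im_le_cabs _) (gM _ tab).
Qed.

Lemma Re_cint_ge a b g m : a <= b -> path_cont a b g ->
  (forall t, a <= t <= b -> m <= Re (g t)) -> m * (b - a) <= Re (cint a b g).
Proof.
move=> ab gc gm /=; rewrite -Rintegral_itv_cst//; apply: le_Rintegral => //.
- by apply: continuous_itv_integrable => t _; exact: cvg_cst.
- exact: path_cont_Re.
Qed.

Lemma Im_cint_ge a b g m : a <= b -> path_cont a b g ->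
  (forall t, a <= t <= b -> m <= Im (g t)) -> m * (b - a) <= Im (cint a b g).
Proof.
move=> ab gc gm /=; rewrite -Rintegral_itv_cst//; apply: le_Rintegral => //.
- by apply: continuous_itv_integrable => t _; exact: cvg_cst.
- exact: path_cont_Im.
Qed.

End PathIntegral.

Section RectangleIntegral.
Context {R : realType}.
Implicit Types (a b c d m t M : R) (F G : R[i] -> R[i]) (k l z : R[i]).
Local Notation Re := (@complex.Re R).
Local Notation Im := (@complex.Im R).

Definition rect a b c d : set R[i] :=
  [set z : R[i] | a <= Re z <= b /\ c <= Im z <= d].

Definition rect_edge a b c d : set R[i] :=
  [set z : R[i] | rect a b c d z /\ (Re z = a \/ Re z = b \/ Im z = c \/
    Im z = d)].

(** The integral of F around the rectangle, counterclockwise.  Opposite sides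
    share one integrand, so that an affine F gives constant integrands. *)
Definition rint a b c d F : R[i] :=
  cint a b (fun x => F (x +i* c)%C - F (x +i* d)%C) +
  'i%C * cint c d (fun y => F (b +i* y)%C - F (a +i* y)%C).

Lemma path_cont_horizontal a b c F :
  (forall t, a <= t <= b -> cont F (t +i* c)%C) ->
  path_cont a b (fun x => F (x +i* c)%C).
Proof.
move=> Fc t /Fc Ft.
have H : (fun x => F (x +i* c)%C) @ t --> F (t +i* c)%C.
  apply: (@cvg_comp _ _ _ (fun x => (x +i* c)%C) F (nbhs t));
    last exact: (cont_cvg Ft).
  by apply: cvg_ReIm; [exact: cvg_id|exact: cvg_cst].
split; apply: (@cvg_comp _ _ _ (fun x => F (x +i* c)%C) _ (nbhs t)) H _.
  exact: Re_continuous.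
exact: Im_continuous.
Qed.

Lemma path_cont_vertical a c d F :
  (forall t, c <= t <= d -> cont F (a +i* t)%C) ->
  path_cont c d (fun y => F (a +i* y)%C).
Proof.
move=> Fc t /Fc Ft.
have H : (fun x => F (a +i* x)%C) @ t --> F (a +i* t)%C.
  apply: (@cvg_comp _ _ _ (fun x => (a +i* x)%C) F (nbhs t));
    last exact: (cont_cvg Ft).
  by apply: cvg_ReIm; [exact: cvg_cst|exact: cvg_id].
split; apply: (@cvg_comp _ _ _ (fun x => F (a +i* x)%C) _ (nbhs t)) H _.
  exact: Re_continuous.
exact: Im_continuous.
Qed.

Section FixedRectangle.
Variables (a b c d : R).
Hypotheses (ab : a <= b) (cd : c <= d).

Lemma edge_bottom t : a <= t <= b -> rect_edge a b c d (t +i* c)%C.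
Proof. by move=> tab; split; [split; rewrite //= lexx|right; right; left]. Qed.
Lemma edge_top t : a <= t <= b -> rect_edge a b c d (t +i* d)%C.
Proof. by move=> tab; split; [split; rewrite //= cd lexx|right; right;
  right]. Qed.
Lemma edge_left t : c <= t <= d -> rect_edge a b c d (a +i* t)%C.
Proof. by move=> tab; split; [split; rewrite //= lexx|left]. Qed.
Lemma edge_right t : c <= t <= d -> rect_edge a b c d (b +i* t)%C.
Proof. by move=> tab; split; [split; rewrite //= ab lexx|right; left]. Qed.

Lemma edge_path_cont F : (forall z, rect_edge a b c d z -> cont F z) ->
  [/\ path_cont a b (fun x => F (x +i* c)%C), path_cont a b (fun x =>
    F (x +i* d)%C),
      path_cont c d (fun y => F (a +i* y)%C) & path_cont c d (fun y =>
        F (b +i* y)%C)].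
Proof.
move=> Fc; split.
- by apply: path_cont_horizontal => t /edge_bottom/Fc.
- by apply: path_cont_horizontal => t /edge_top/Fc.
- by apply: path_cont_vertical => t /edge_left/Fc.
- by apply: path_cont_vertical => t /edge_right/Fc.
Qed.

Lemma eq_rint F G : (forall z, rect_edge a b c d z -> F z = G z) ->
  rint a b c d F = rint a b c d G.
Proof.
move=> FG; congr (_ + 'i%C * _); apply: eq_cint => t tt.
  by rewrite !FG//; [exact: edge_top|exact: edge_bottom].
by rewrite !FG//; [exact: edge_left|exact: edge_right].
Qed.

Lemma rintD F G : (forall z, rect_edge a b c d z -> cont F z) ->
  (forall z, rect_edge a b c d z -> cont G z) ->
  rint a b c d (fun z => F z + G z) = rint a b c d F + rint a b c d G.
Proof.
move=> /edge_path_cont[F1 F2 F3 F4] /edge_path_cont[G1 G2 G3 G4]; rewrite /rint.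
by rewrite !cintB ?cintD//; [ring|exact: path_contD..].
Qed.

Lemma rintZ k F : (forall z, rect_edge a b c d z -> cont F z) ->
  rint a b c d (fun z => k * F z) = k * rint a b c d F.
Proof.
move=> /edge_path_cont[F1 F2 F3 F4]; rewrite /rint.
rewrite mulrDr mulrCA; congr (_ + 'i%C * _);
  by rewrite -cintZ; [apply: eq_cint => t _; rewrite mulrBr|exact: path_contB].
Qed.

Lemma rint_bound F M : (forall z, rect_edge a b c d z -> cont F z) ->
  (forall z, rect_edge a b c d z -> cabs (F z) <= M) ->
  cabs (rint a b c d F) <= 4 * M * ((b - a) + (d - c)).
Proof.
move=> /edge_path_cont[F1 F2 F3 F4] FM.
rewrite mulrDr; apply: le_trans (cabsD _ _) _; apply: lerD.
  rewrite (_ : 4 * M = 2 * (M + M)); last by lra.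
  apply: cint_bound => //; first exact: path_contB.
  move=> t tt; apply: le_trans (cabsD _ _) _; rewrite cabsN.
  by apply: lerD; apply: FM; [exact: edge_bottom|exact: edge_top].
have -> : forall z, cabs ('i%C * z) = cabs z.
  by move=> z; rewrite cabsM [cabs 'i%C]cabsE/= expr0n expr1n add0r sqrtr1
    mul1r.
rewrite (_ : 4 * M = 2 * (M + M)); last by lra.
apply: cint_bound => //; first exact: path_contB.
move=> t tt; apply: le_trans (cabsD _ _) _; rewrite cabsN.
by apply: lerD; apply: FM; [exact: edge_right|exact: edge_left].
Qed.

Lemma rint_affine k l : rint a b c d (fun z => k + l * z) = 0.
Proof.
rewrite /rint (@eq_cint _ _ _ _ (fun=> l * (0 +i* (c - d))%C)); last first.
  by move=> t _; apply: complex_eqP;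
    rewrite !(cReB,cImB,cReD,cImD,cReM,cImM)/=; ring.
rewrite (@eq_cint _ c d _ (fun=> l * ((b - a)%:C)%C)); last first.
  by move=> t _; apply: complex_eqP;
    rewrite !(cReB,cImB,cReD,cImD,cReM,cImM)/=; ring.
rewrite !cint_cst//.
by apply: complex_eqP; rewrite !(cReB,cImB,cReD,cImD,cReM,cImM)/=; ring.
Qed.

End FixedRectangle.

(** The two integrals along the common side cancel. *)
Lemma rint_splitx a m b c d F : a <= m <= b -> c <= d ->
  (forall z, rect a b c d z -> cont F z) ->
  rint a b c d F = rint a m c d F + rint m b c d F.
Proof.
move=> /andP[am mb] cd Fc; have ab := le_trans am mb.
rewrite /rint (@cint_split _ a m b) ?am//; last first.
  apply: path_contB; apply: path_cont_horizontal => t tt; apply: Fc;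
    by split; rewrite //= lexx cd.
have Hv x : a <= x <= b -> path_cont c d (fun y => F (x +i* y)%C).
  by move=> xx; apply: path_cont_vertical => t tt; apply: Fc; split.
have Ha := Hv a; have Hm := Hv m; have Hb := Hv b.
move: Ha Hm Hb; rewrite !lexx ab am mb => /(_ isT) Ha /(_ isT) Hm /(_ isT) Hb.
by rewrite !(@cintB _ c d)//; ring.
Qed.

Lemma rint_splity a b c m d F : a <= b -> c <= m <= d ->
  (forall z, rect a b c d z -> cont F z) ->
  rint a b c d F = rint a b c m F + rint a b m d F.
Proof.
move=> ab /andP[cm md] Fc; have cd := le_trans cm md.
rewrite /rint (@cint_split _ c m d) ?cm//; last first.
  apply: path_contB; apply: path_cont_vertical => t tt; apply: Fc;
    by split; rewrite //= lexx ab.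
have Hv x : c <= x <= d -> path_cont a b (fun y => F (y +i* x)%C).
  by move=> xx; apply: path_cont_horizontal => t tt; apply: Fc; split.
have Hc := Hv c; have Hm := Hv m; have Hd := Hv d.
move: Hc Hm Hd; rewrite !lexx cd cm md => /(_ isT) Hc /(_ isT) Hm /(_ isT) Hd.
by rewrite !(@cintB _ a b)//; ring.
Qed.

End RectangleIntegral.

(** * Complex differentiability in Caratheodory form *)

Section ComplexDifferentiability.
Context {R : realType}.
Implicit Types (z w u p k : R[i]) (f g q : R[i] -> R[i]) (A : set R[i]).

Definition cdiff f p : Prop :=
  exists2 q, cont q p & forall u, f u = f p + (u - p) * q u.

(** The difference quotient of f at p, with value k filled in at p. *)
Definition dq f p k u : R[i] := if u == p then k else (f u - f p) / (u - p).

Lemma cont_near f g p (e : R) : 0 < e ->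
  (forall u, cabs (u - p) < e -> f u = g u) -> cont f p -> cont g p.
Proof.
move=> e0 fg /contP fp; apply/contP => r /fp[d d0 dP].
exists (Num.min d e); first by rewrite lt_min d0.
move=> u; rewrite lt_min => /andP[ud ue]; rewrite -!fg//; first exact: dP.
by rewrite subrr cabs0.
Qed.

Lemma eq_cont f g p : f =1 g -> cont f p -> cont g p.
Proof. by move=> /funext ->. Qed.

Lemma eq_cdiff f g p : f =1 g -> cdiff f p -> cdiff g p.
Proof. by move=> /funext ->. Qed.

Lemma cdiffP f p : cdiff f p <-> exists k, cont (dq f p k) p.
Proof.
split=> [[q qp fq]|[k kp]].
  exists (q p); apply: eq_cont qp => u; rewrite /dq.
  have [->//|up] := eqVneq u p.
  by rewrite fq addrC addKr mulrC mulKf// subr_eq0.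
exists (dq f p k) => // u; rewrite /dq; have [->|up] := eqVneq u p.
  by rewrite subrr mul0r addr0.
by rewrite mulrC divfK ?subr_eq0// addrC subrK.
Qed.

Lemma cdiff_near f g p (e : R) : 0 < e ->
  (forall u, cabs (u - p) < e -> f u = g u) -> cdiff f p -> cdiff g p.
Proof.
move=> e0 fg /cdiffP[k kp]; apply/cdiffP; exists k.
apply: (cont_near e0 _ kp) => u up.
by rewrite /dq !fg// subrr cabs0.
Qed.

Lemma cdiff_cont f p : cdiff f p -> cont f p.
Proof.
move=> [q qp fq]; apply: (@eq_cont (fun u => f p + (u - p) * q u)).
  by move=> u; rewrite -fq.
apply: contD; first exact: cont_cst.
by apply: contM => //; exact: cont_subl.
Qed.

Lemma cdiff_cst k p : cdiff (fun=> k) p.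
Proof. by exists (fun=> 0) => [|u]; [exact: cont_cst|rewrite mulr0 addr0]. Qed.

Lemma cdiff_id p : cdiff id p.
Proof. by exists (fun=> 1) => [|u];
  [exact: cont_cst|rewrite mulr1 addrC subrK]. Qed.

Lemma cdiffD f g p : cdiff f p -> cdiff g p -> cdiff (fun u => f u + g u) p.
Proof.
move=> [q qp fq] [r rp gr]; exists (fun u => q u + r u); first exact: contD.
by move=> u; rewrite fq gr; ring.
Qed.

Lemma cdiffM f g p : cdiff f p -> cdiff g p -> cdiff (fun u => f u * g u) p.
Proof.
move=> fp gp; have gc := cdiff_cont gp; move: fp gp => [q qp fq] [r rp gr].
exists (fun u => f p * r u + q u * g u).
  by apply: contD; apply: contM => //; exact: cont_cst.
move=> u; have Ef : f u - f p = (u - p) * q u by rewrite fq addrC addKr.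
have Eg : g u - g p = (u - p) * r u by rewrite gr addrC addKr.
transitivity (f p * g p + f p * (g u - g p) + (f u - f p) * g u); first by ring.
by rewrite Ef Eg; ring.
Qed.

Lemma cdiffN f p : cdiff f p -> cdiff (fun u => - f u) p.
Proof.
move=> fp; apply: (@eq_cdiff (fun u => -1 * f u)).
  by move=> u; rewrite mulN1r.
by apply: cdiffM => //; exact: cdiff_cst.
Qed.

Lemma cdiffB f g p : cdiff f p -> cdiff g p -> cdiff (fun u => f u - g u) p.
Proof. by move=> fp gp; apply: cdiffD => //; exact: cdiffN. Qed.

Lemma cdiffX f n p : cdiff f p -> cdiff (fun u => f u ^+ n) p.
Proof.
move=> fp; elim: n => [|n IH]; first exact: cdiff_cst.
apply: (@eq_cdiff (fun u => f u * f u ^+ n)); last exact: cdiffM.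
by move=> u; rewrite exprS.
Qed.

Lemma cont_neq0 f p : cont f p -> f p != 0 ->
  exists2 e : R, 0 < e & forall u, cabs (u - p) < e -> f u != 0.
Proof.
move=> /contP fp fp0; have [|e e0 eP] := fp (cabs (f p)).
  by rewrite cabs_gt0.
exists e => // u /eP; apply: contraTneq => ->.
by rewrite sub0r cabsN ltxx.
Qed.

Lemma cdiffV f p : f p != 0 -> cdiff f p -> cdiff (fun u => (f u)^-1) p.
Proof.
move=> fp0 fp; have fc := cdiff_cont fp; have [e e0 eP] := cont_neq0 fc fp0.
case: fp => q qp fq; apply/cdiffP; exists (- q p / f p / f p).
apply: (@cont_near (fun u => - q u / f u / f p) _ _ e) => //.
  move=> u /eP fu; rewrite /dq; have [->//|up] := eqVneq u p.
  have up0 : u - p != 0 by rewrite subr_eq0.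
  have -> : q u = (f u - f p) / (u - p).
    by rewrite (fq u) [f p + _]addrC addrK mulrC mulKf.
  by field; rewrite fp0 up0 fu.
apply: contM; last exact: cont_cst.
apply: contM; last exact: contV.
exact: contN.
Qed.

Lemma cdiff_comp f g p : cdiff f p -> cdiff g (f p) -> cdiff (g \o f) p.
Proof.
move=> fp; have fc := cdiff_cont fp; case: fp => q qp fq [r rp gr].
exists (fun u => q u * r (f u)).
  by apply: contM => //; exact: cont_comp.
move=> u /=; have Ef : f u - f p = (u - p) * q u by rewrite fq addrC addKr.
by rewrite gr Ef; ring.
Qed.

Lemma cdiff_subl w p : cdiff (fun u => u - w) p.
Proof. exact: (cdiffB (f := id) (g := fun=> w) (cdiff_id p) (cdiff_cst w p)).
  Qed.

Lemma cdiff_inv w p : p != w -> cdiff (fun u => (u - w)^-1) p.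
Proof. by move=> pw; apply: cdiffV; [rewrite subr_eq0|exact: cdiff_subl]. Qed.

(** Away from w, the Caratheodory quotient is an honest quotient by z - w. *)
Lemma cdiff_quotient f q w u : u != w -> cdiff f u ->
  (forall z, f z = f w + (z - w) * q z) -> cdiff q u.
Proof.
move=> uw fu fq.
have uw0 : 0 < cabs (u - w) by rewrite cabs_gt0 subr_eq0.
apply: (@cdiff_near (fun z => (f z - f w) * (z - w)^-1) _ _ (cabs (u - w))) =>
  //.
  move=> z zu; rewrite fq addrC addKr mulrC mulKf// subr_eq0.
  by apply: contraTneq zu => ->; rewrite cabsC ltxx.
apply: cdiffM; last exact: cdiff_inv.
by apply: cdiffB => //; exact: cdiff_cst.
Qed.

Lemma cont_bound f A : compact A -> (forall z, A z -> cont f z) ->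
  exists2 M : R, 0 < M & forall z, A z -> cabs (f z) <= M.
Proof.
move=> cA fA; have [|M M0 MP] := @compact_bound _ (f @` A).
  apply: continuous_compact => //; apply: continuous_in_subspaceT => z.
  by move=> /set_mem/fA/cont_cvg.
by exists M => // z Az; apply: MP; exists z.
Qed.

Lemma derivableE f p : derivable f p 1 <-> cdiff f p.
Proof.
rewrite cdiffP; split=> [/cvg_ex[k fk]|[k fk]]; last apply/cvg_ex; exists k.
  apply/contP => e e0.
  have [d d0 dP] : exists2 d : R, 0 < d & forall h, cabs (h - 0) < d ->
    h != 0 ->
      cabs (h^-1 *: (f (h *: 1 + p) - f p) - k) < e.
    have /(_ _ e e0) := (@cvg_cabs _ _ (0^') _ _ k).1 fk.
    by rewrite near_withinE => H; apply/nbhs_cabs; exact: H.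
  exists d => // u ud; rewrite /dq eqxx; case: eqVneq => [_|up].
    by rewrite subrr cabs0.
  have := dP (u - p); rewrite subr0 subr_eq0 => /(_ ud up).
  by rewrite scaler1 subrK [_ *: _]mulrC.
apply: (@cvg_cabs _ _ (0^') _ _ k).2 => e e0; rewrite near_withinE.
apply/nbhs_cabs.
have /contP/(_ e e0)[d d0 dP] := fk.
exists d => // h; rewrite subr0 => hd h0.
have := dP (h + p); rewrite addrK => /(_ hd).
rewrite /dq eqxx; case: eqVneq => [/eqP|_].
  by rewrite -subr_eq0 addrK (negbTE h0).
by rewrite addrK scaler1 [_ *: _]mulrC.
Qed.

End ComplexDifferentiability.

(** * Goursat's theorem for rectangles *)

Section Goursat.
Context {R : realType}.
Implicit Types (a b c d m t M : R) (F G : R[i] -> R[i]) (k l z w p : R[i]).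
Local Notation Re := (@complex.Re R).
Local Notation Im := (@complex.Im R).

Lemma rectS a b c d a' b' c' d' : a <= a' -> b' <= b -> c <= c' -> d' <= d ->
  rect a' b' c' d' `<=` rect a b c d.
Proof.
move=> aa bb cc dd z [/andP[z1 z2] /andP[z3 z4]]; split.
  by rewrite (le_trans aa) ?(le_trans _ bb).
by rewrite (le_trans cc) ?(le_trans _ dd).
Qed.

(** The four quarters add up to the whole, so one of them carries at least a
    quarter of the integral. *)
Lemma rint_quarter a b c d F (K : R) : a <= b -> c <= d ->
  (forall z, rect a b c d z -> cont F z) -> K <= cabs (rint a b c d F) ->
  exists a' b' c' d' : R,
    [/\ a <= a' /\ b' <= b, c <= c' /\ d' <= d,
        b' - a' = (b - a) / 2, d' - c' = (d - c) / 2
      & K / 4 <= cabs (rint a' b' c' d' F)].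
Proof.
move=> ab cd Fc; pose m := (a + b) / 2; pose n := (c + d) / 2.
have ma : m - a = (b - a) / 2 by rewrite /m; field.
have bm : b - m = (b - a) / 2 by rewrite /m; field.
have nc : n - c = (d - c) / 2 by rewrite /n; field.
have dn : d - n = (d - c) / 2 by rewrite /n; field.
have am : a <= m by rewrite /m; lra.
have mb : m <= b by rewrite /m; lra.
have cn : c <= n by rewrite /n; lra.
have nd : n <= d by rewrite /n; lra.
have E : rint a b c d F = (rint a m c n F + rint a m n d F) +
                          (rint m b c n F + rint m b n d F).
  rewrite (@rint_splitx _ a m) ?am// (@rint_splity _ a m c n) ?cn//.
    by rewrite (@rint_splity _ m b c n) ?cn// => z Hz; apply: Fc;
      apply: rectS Hz.
  by move=> z Hz; apply: Fc; apply: rectS Hz.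
have : cabs (rint a b c d F) <=
    cabs (rint a m c n F) + cabs (rint a m n d F) +
    (cabs (rint m b c n F) + cabs (rint m b n d F)).
  by rewrite E (le_trans (cabsD _ _))// lerD// cabsD.
move=> EF /le_trans /(_ EF){E EF} KF.
have [H1|H1] := lerP (K / 4) (cabs (rint a m c n F));
  first by exists a, m, c, n.
have [H2|H2] := lerP (K / 4) (cabs (rint a m n d F));
  first by exists a, m, n, d.
have [H3|H3] := lerP (K / 4) (cabs (rint m b c n F));
  first by exists m, b, c, n.
exists m, b, n, d; split=> //; move: KF H1 H2 H3.
move: (cabs _) (cabs _) (cabs _) (cabs _) =>
  x y z t {ab cd Fc am mb cn nd ma bm nc dn}.
by lra.
Qed.

(** Near p, F is an affine function plus an error that is small compared with
    z - p, and affine functions have integral 0.  The bound is quadratic in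
    the size of the rectangle: it decays like the area. *)
Lemma rint_local F p (e : R) : 0 < e -> cdiff F p ->
  exists2 r : R, 0 < r & forall a b c d, a <= b -> c <= d ->
    (forall z, rect a b c d z -> cont F z) -> rect a b c d p ->
    (b - a) + (d - c) < r ->
    cabs (rint a b c d F) <= e * ((b - a) + (d - c)) ^+ 2.
Proof.
move=> e0 [q /contP qp Fq]; have e4 : 0 < e / 4 by rewrite divr_gt0.
have [r r0 rP] := qp _ e4; exists r => // a b c d ab cd Fc pR Lr.
set L := (b - a) + (d - c) in Lr *.
have -> : rint a b c d F =
    rint a b c d (fun z => F z + ((p * q p - F p) + (- q p) * z)).
  rewrite rintD// ?rint_affine ?addr0//.
    by move=> z [zR _]; exact: Fc.
  move=> z _; apply: contD; first exact: cont_cst.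
  by apply: contM; [exact: cont_cst|exact: cont_id].
have -> : e * L ^+ 2 = 4 * (e / 4 * L) * L by field.
apply: rint_bound => //.
  move=> z [/Fc Fz _]; apply: contD => //; apply: contD; first exact: cont_cst.
  by apply: contM; [exact: cont_cst|exact: cont_id].
move=> z [zR _].
have -> : F z + (p * q p - F p + - q p * z) = (q z - q p) * (z - p).
  by rewrite Fq; ring.
have zp : cabs (z - p) <= L.
  apply: le_trans (cabs_le_ReIm _) _; rewrite cReB cImB.
  move: zR pR => [/andP[? ?] /andP[? ?]] [/andP[? ?] /andP[? ?]].
  by apply: lerD; rewrite ler_norml; apply/andP; split; lra.
rewrite cabsM; apply: ler_pM => //; try exact: cabs_ge0.
by apply/ltW/rP; exact: le_lt_trans Lr.
Qed.

Lemma halves_small (L r : R) : 0 < r -> exists n : nat, L / 2 ^+ n < r.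
Proof.
move=> r0; have [L0|L0] := lerP L 0.
  by exists 0%N; rewrite expr0 divr1; exact: le_lt_trans r0.
have h : `|2^-1 : R| < 1 by rewrite ger0_norm//; lra.
have /cvgrPdist_lt/(_ (r / L)) := cvg_expr h.
rewrite divr_gt0// => /(_ isT)[n _ /(_ n (leqnn n))].
rewrite sub0r normrN exprVn ger0_norm ?invr_ge0 ?exprn_ge0// => H.
by exists n; rewrite mulrC -ltr_pdivlMr.
Qed.

(** Repeated quartering gives rectangles that shrink to a point p.  Their
    integrals are at least K / 4 ^ n, whereas differentiability at p bounds them
    by e * (L / 2 ^ n) ^ 2 for every e, where L is the initial half-perimeter. *)
Theorem goursat a b c d F : a <= b -> c <= d ->
  (forall z, rect a b c d z -> cdiff F z) -> rint a b c d F = 0.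
Proof.
move=> ab cd Fd; have Fc z : rect a b c d z -> cont F z by move/Fd/cdiff_cont.
apply/eqP; rewrite -cabs_eq0 eq_le cabs_ge0 andbT leNgt; apply/negP.
set K := cabs _ => K0.
pose T := (R * R * R * R)%type.
pose good (r : T) := let '(a', b', c', d') := r in
  [/\ a' <= b', c' <= d' & rect a' b' c' d' `<=` rect a b c d].
pose size (r : T) := let '(a', b', c', d') := r in (b' - a') + (d' - c').
pose I (r : T) := let '(a', b', c', d') := r in cabs (rint a' b' c' d' F).
pose S (r : T) := let '(a', b', c', d') := r in rect a' b' c' d'.
pose next (r r' : T) := [/\ good r', S r' `<=` S r, size r' = size r / 2 &
   I r / 4 <= I r'].
have step r : exists r', good r -> next r r'.
  case: r => [[[a1 b1] c1] d1].
  have [[ab1 cd1 sub]|ng] := pselect (good (a1, b1, c1, d1)); last first.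
    by exists (a1, b1, c1, d1).
  have [|a2 [b2 [c2 [d2 [[aa bb] [cc dd] sx sy KI]]]]] :=
    rint_quarter ab1 cd1 _ (lexx (cabs (rint a1 b1 c1 d1 F))).
    by move=> z /sub/Fc.
  have s2 : rect a2 b2 c2 d2 `<=` rect a1 b1 c1 d1 by exact: rectS.
  exists (a2, b2, c2, d2) => _; split => //; rewrite /size;
    last by rewrite sx sy; lra.
  have [a2b2 c2d2] : a2 <= b2 /\ c2 <= d2.
    by clear -ab1 cd1 sx sy; split; lra.
  by split => //; exact: subset_trans sub.
have [nx nxP] := choice step.
pose r n := iter n nx (a, b, c, d).
have rg n : good (r n).
  elim: n => [|n IH] /=; first by split.
  by have [] := nxP _ IH.
have rS n : S (r n.+1) `<=` S (r n) by have [] := nxP _ (rg n).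
have rsz n : size (r n) = ((b - a) + (d - c)) / 2 ^+ n.
  elim: n => [|n IH]; first by rewrite expr0 divr1.
  have [_ _ -> _] := nxP _ (rg n); rewrite -/(r n) IH exprS invfM; ring.
have rI n : K / 4 ^+ n <= I (r n).
  elim: n => [|n IH]; first by rewrite expr0 divr1.
  have [_ _ _] := nxP _ (rg n); rewrite -/(r n); apply: le_trans.
  by rewrite exprS invfM mulrCA mulrC ler_wpM2r// invr_ge0.
have [|||p pP] := @nested_compact _ (fun n => S (r n)).
- by move=> n; case: (r n) => [[[a1 b1] c1] d1]; exact: compact_rect.
- move=> n; move: (rg n); rewrite /good /S;
  case: (r n) => [[[a1 b1] c1] d1] [h1 h2 _].
  by exists (a1 +i* c1)%C; split; rewrite /= lexx.
- exact: rS.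
set L := (b - a) + (d - c) in rsz.
have L0 : 0 <= L by rewrite /L; lra.
(* small enough for e * L ^+ 2 < K; the added 1 keeps it defined if L = 0 *)
pose e := K / (2 * (L ^+ 2 + 1)).
have L20 : 0 < L ^+ 2 + 1 by rewrite ltr_wpDl// sqr_ge0.
have e0 : 0 < e by rewrite divr_gt0// mulr_gt0.
have [s s0 sP] := rint_local e0 (Fd p (pP 0%N)).
have [n nP] := halves_small L s0.
have : I (r n) <= e * (size (r n)) ^+ 2.
  move: (rg n) (pP n) (rsz n); rewrite /good /S /I /size.
  case: (r n) => [[[a1 b1] c1] d1] [h1 h2 sub] pn E.
  by apply: sP => //; [move=> z /sub/Fc|rewrite E].
rewrite rsz => H; have := le_trans (rI n) H.
have -> : e * (L / 2 ^+ n) ^+ 2 = e * L ^+ 2 / 4 ^+ n.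
  by rewrite expr_div_n -exprM mulnC exprM mulrA (_ : 2 ^+ 2 = 4)//; ring.
rewrite ler_pM2r ?invr_gt0 ?exprn_gt0// leNgt => /negP; apply.
have <- : e * (2 * (L ^+ 2 + 1)) = K by rewrite divfK// gt_eqF// mulr_gt0.
by rewrite ltr_pM2l//; have := sqr_ge0 L; lra.
Qed.

Lemma rint_degx a c d F : c <= d -> (forall z, rect a a c d z -> cont F z) ->
  rint a a c d F = 0.
Proof.
move=> cd Fc; have := @rint_splitx _ a a a c d F;
  rewrite lexx => /(_ isT cd Fc).
by move=> /eqP; rewrite -subr_eq0 opprD addrA subrr sub0r oppr_eq0 => /eqP.
Qed.

Lemma rint_degy a b c F : a <= b -> (forall z, rect a b c c z -> cont F z) ->
  rint a b c c F = 0.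
Proof.
move=> ab Fc; have := @rint_splity _ a b c c c F;
  rewrite lexx => /(_ ab isT Fc).
by move=> /eqP; rewrite -subr_eq0 opprD addrA subrr sub0r oppr_eq0 => /eqP.
Qed.

(** All of the integral is carried by an arbitrarily small rectangle around p,
    on which F is bounded. *)
Lemma rint_excision a b c d F p : a <= b -> c <= d ->
  (forall z, rect a b c d z -> cont F z) ->
  (forall a' b' c' d', a' <= b' -> c' <= d' ->
     rect a' b' c' d' `<=` rect a b c d -> ~ rect a' b' c' d' p ->
     rint a' b' c' d' F = 0) ->
  rint a b c d F = 0.
Proof.
move=> ab cd Fc F0.
have [[/andP[ap pb] /andP[cp pd]]|np] := pselect (rect a b c d p); last first.
  exact: F0.
have [M M0 MP] := cont_bound (compact_rect (a:=a) (b:=b) (c:=c) (d:=d)) Fc.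
apply/eqP; rewrite -cabs_eq0 eq_le cabs_ge0 andbT leNgt; apply/negP.
set K := cabs _ => K0.
(* the small rectangle has sides at most 2 e, so it contributes at most
   4 M (4 e) = K / 2 *)
pose e := K / (32 * M).
have e0 : 0 < e by rewrite divr_gt0// mulr_gt0.
pose a1 := Num.max a (Re p - e); pose b1 := Num.min b (Re p + e).
pose c1 := Num.max c (Im p - e); pose d1 := Num.min d (Im p + e).
have aa : a <= a1 by rewrite le_max lexx.
have bb : b1 <= b by rewrite ge_min lexx.
have cc : c <= c1 by rewrite le_max lexx.
have dd : d1 <= d by rewrite ge_min lexx.
have a1p : a1 <= Re p by rewrite ge_max ap/=; lra.
have b1p : Re p <= b1 by rewrite le_min pb/=; lra.
have c1p : c1 <= Im p by rewrite ge_max cp/=; lra.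
have d1p : Im p <= d1 by rewrite le_min pd/=; lra.
have Fs a2 b2 c2 d2 : a <= a2 -> b2 <= b -> c <= c2 -> d2 <= d ->
    forall z, rect a2 b2 c2 d2 z -> cont F z.
  by move=> ? ? ? ? z zR; apply: Fc; apply: rectS zR.
have E1 : rint a a1 c d F = 0.
  have [a1E|a1E] := leP (Re p - e) a.
    rewrite (_ : a1 = a) ?rint_degx//; first by apply: Fs => //; lra.
    exact/max_idPl.
  have a1E' : a1 = Re p - e by apply/max_idPr/ltW.
  apply: F0 => //; first by apply: rectS => //; lra.
  by move=> [/andP[_ H] _]; lra.
have E2 : rint b1 b c d F = 0.
  have [a1E|a1E] := leP b (Re p + e).
    rewrite (_ : b1 = b) ?rint_degx//; first by apply: Fs => //; lra.
    exact/min_idPl.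
  have a1E' : b1 = Re p + e by apply/min_idPr/ltW.
  apply: F0 => //; first by apply: rectS => //; lra.
  by move=> [/andP[H _] _]; lra.
have E3 : rint a1 b1 c c1 F = 0.
  have [a1E|a1E] := leP (Im p - e) c.
    rewrite (_ : c1 = c) ?rint_degy//; [lra|by apply: Fs => //; lra|].
    exact/max_idPl.
  have a1E' : c1 = Im p - e by apply/max_idPr/ltW.
  apply: F0 => //; [lra|by apply: rectS => //; lra|].
  by move=> [_ /andP[_ H]]; lra.
have E4 : rint a1 b1 d1 d F = 0.
  have [a1E|a1E] := leP d (Im p + e).
    rewrite (_ : d1 = d) ?rint_degy//; [lra|by apply: Fs => //; lra|].
    exact/min_idPl.
  have a1E' : d1 = Im p + e by apply/min_idPr/ltW.
  apply: F0 => //; [lra|by apply: rectS => //; lra|].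
  by move=> [_ /andP[H _]]; lra.
have E : rint a b c d F = rint a1 b1 c1 d1 F.
  rewrite (@rint_splitx _ a a1)//; last by apply/andP; split; lra.
  rewrite (@rint_splitx _ a1 b1)//; last by apply: Fs => //; lra.
    rewrite (@rint_splity _ a1 b1 c c1)//; last by apply: Fs => //; lra.
    - rewrite (@rint_splity _ a1 b1 c1 d1)//; last by apply: Fs => //; lra.
      + by rewrite E1 E2 E3 E4 !(addr0, add0r).
      + lra.
      + by apply/andP; split; lra.
    - lra.
    - by apply/andP; split; lra.
  by apply/andP; split; lra.
have : cabs (rint a1 b1 c1 d1 F) <= 4 * M * ((b1 - a1) + (d1 - c1)).
  apply: rint_bound => //; [lra|lra| |].
    by move=> z [zR _]; apply: Fs zR.
  by move=> z [zR _]; apply: MP; apply: rectS zR.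
rewrite -E -/K; apply/negP; rewrite -ltNge.
have h1 : Re p - e <= a1 by rewrite le_max lexx orbT.
have h2 : b1 <= Re p + e by rewrite ge_min lexx orbT.
have h3 : Im p - e <= c1 by rewrite le_max lexx orbT.
have h4 : d1 <= Im p + e by rewrite ge_min lexx orbT.
apply: (@le_lt_trans _ _ (4 * M * (4 * e))).
  by rewrite ler_pM2l ?mulr_gt0//; lra.
have -> : 4 * M * (4 * e) = K / 2 by rewrite /e; field; rewrite gt_eqF.
lra.
Qed.

Lemma goursat_except a b c d F p : a <= b -> c <= d ->
  (forall z, rect a b c d z -> cont F z) ->
  (forall z, rect a b c d z -> z != p -> cdiff F z) -> rint a b c d F = 0.
Proof.
move=> ab cd Fc Fd; apply: (rint_excision (p := p)) =>
  // a' b' c' d' ab' cd' sub np.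
by apply: goursat => // z zR; apply: Fd;
  [exact: sub|apply: contra_notN np => /eqP <-].
Qed.

End Goursat.

(** * Cauchy's formula, the maximum principle, removable singularities *)

Section CauchyFormula.
Context {R : realType}.
Implicit Types (a b c d m t M : R) (F G : R[i] -> R[i]) (k l z w p u : R[i]).
Local Notation Re := (@complex.Re R).
Local Notation Im := (@complex.Im R).

Definition inner_rect a b c d : set R[i] :=
  [set z : R[i] | a < Re z < b /\ c < Im z < d].

Lemma cont_unique f g p (e : R) : 0 < e -> cont f p -> cont g p ->
  (forall u, u != p -> cabs (u - p) < e -> f u = g u) -> f p = g p.
Proof.
move=> e0 fp gp fg; apply/eqP; apply: contrapT => /negP;
  rewrite -subr_eq0 => fg0.
have [|r r0 rP] := cont_neq0 (contB fp gp); first exact: fg0.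
pose h := (Num.min e r) / 2.
have m0 : 0 < Num.min e r by rewrite lt_min e0.
have h0 : 0 < h by rewrite divr_gt0.
have hE : cabs ((p + h%:C%C) - p) = h by rewrite addrC addKr cabs_real
  gtr0_norm.
have hm : h < Num.min e r by rewrite /h; lra.
move: (hm); rewrite lt_min => /andP[he hr].
have := rP (p + h%:C%C); rewrite hE => /(_ hr); rewrite fg ?hE ?subrr ?eqxx//.
by rewrite -subr_eq0 -cabs_eq0 hE gt_eqF.
Qed.

Lemma cdiff_local F q p (e : R) : 0 < e -> cont q p ->
  (forall u, cabs (u - p) < e -> F u = F p + (u - p) * q u) -> cdiff F p.
Proof.
move=> e0 qp Fq; apply/cdiffP; exists (q p).
apply: (cont_near e0 _ qp) => u up; rewrite /dq.
case: eqVneq => [->//|up0]; rewrite (Fq u up) [F p + _]addrC addrK mulrC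
  mulKf//.
by rewrite subr_eq0.
Qed.

Section Kernel.
Variables (a b c d : R).
Hypotheses (ab : a < b) (cd : c < d).
Let abW := ltW ab.
Let cdW := ltW cd.

(** Without the usual factor 1 / (2 i pi): the transform of the constant 1
    stands in for 2 i pi, and only its being non-zero matters. *)
Definition cauchy_transform F w : R[i] := rint a b c d (fun z =>
  F z * (z - w)^-1).

Lemma inner_rectW w : inner_rect a b c d w -> rect a b c d w.
Proof. by move=> [/andP[/ltW ? /ltW ?] /andP[/ltW ? /ltW ?]]; split;
  apply/andP. Qed.

Lemma edge_dist w : inner_rect a b c d w -> exists2 r : R, 0 < r &
  forall z, rect_edge a b c d z -> r <= cabs (z - w).
Proof.
move=> [/andP[w1 w2] /andP[w3 w4]].
exists (Num.min (Num.min (Re w - a) (b - Re w)) (Num.min (Im w - c) (d - Im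
  w))).
  by rewrite !lt_min !subr_gt0 w1 w2 w3 w4.
move=> z [_]; have := Re_le_cabs (z - w); have := Im_le_cabs (z - w).
rewrite cReB cImB !ge_min => /ler_normlP[i1 i2] /ler_normlP[r1 r2].
move: (cabs _) i1 i2 r1 r2 => x i1 i2 r1 r2.
case=> [E|[E|[E|E]]]; rewrite {}E in i1 i2 r1 r2; apply/orP;
  by [left; apply/orP; left; lra|left; apply/orP; right; lra|
      right; apply/orP; left; lra|right; apply/orP; right; lra].
Qed.

Lemma edge_neq w z : inner_rect a b c d w -> rect_edge a b c d z -> z != w.
Proof.
move=> /edge_dist[r r0 rP] /rP zr; rewrite -subr_eq0 -cabs_gt0.
exact: lt_le_trans zr.
Qed.

Lemma edge_kernel_cont F w : inner_rect a b c d w ->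
  (forall z, rect_edge a b c d z -> cont F z) ->
  forall z, rect_edge a b c d z -> cont (fun z => F z * (z - w)^-1) z.
Proof.
move=> wi Fc z ze; apply: contM; first exact: Fc.
apply: contV; last exact: cont_subl.
by rewrite subr_eq0; exact: edge_neq ze.
Qed.

(** The quotient (F z - F w) / (z - w) is continuous, and differentiable off w,
    so its integral vanishes by Goursat with one exceptional point. *)
Lemma cauchy_formula F w : inner_rect a b c d w ->
  (forall z, rect a b c d z -> cdiff F z) ->
  cauchy_transform F w = F w * cauchy_transform (fun=> 1) w.
Proof.
move=> wi Fd; have [q qw Fq] := Fd _ (inner_rectW wi).
have q0 : rint a b c d q = 0.
  have qd z : rect a b c d z -> z != w -> cdiff q z.
    by move=> zR zw; apply: cdiff_quotient zw (Fd _ zR) Fq.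
  apply: (goursat_except (p := w)) => // z zR.
  by have [->//|zw] := eqVneq z w; apply/cdiff_cont/qd.
have Fc z : rect_edge a b c d z -> cont F z by move=> [/Fd/cdiff_cont].
have c1 z : rect_edge a b c d z -> cont (fun=> 1) z by move=> _;
  exact: cont_cst.
have K1 := edge_kernel_cont wi c1.
rewrite /cauchy_transform -rintZ// -[RHS]add0r -q0 -rintD//.
- apply: eq_rint => // z ze; have zw := edge_neq wi ze;
  rewrite (Fq z) mulrDl mul1r.
  by rewrite [(z - w) * _]mulrC mulfK ?subr_eq0// addrC.
- move=> z [zR ze]; apply/cdiff_cont/(cdiff_quotient _ (Fd _ zR) Fq).
  by apply: (edge_neq wi); split.
- by move=> z ze; apply: contM; [exact: cont_cst|exact: K1].
Qed.

Lemma cauchy_transform_bound F w M r : 0 < r -> inner_rect a b c d w ->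
  (forall z, rect_edge a b c d z -> cont F z) ->
  (forall z, rect_edge a b c d z -> cabs (F z) <= M) ->
  (forall z, rect_edge a b c d z -> r <= cabs (z - w)) ->
  cabs (cauchy_transform F w) <= 4 * (M / r) * ((b - a) + (d - c)).
Proof.
move=> r0 wi Fc FM Fr; apply: rint_bound => //; first exact: edge_kernel_cont.
move=> z ze; rewrite cabsM cabsV; apply: ler_pM; rewrite ?invr_ge0 ?cabs_ge0//.
  exact: FM.
by rewrite lef_pV2 ?posrE ?Fr// (lt_le_trans r0) ?Fr.
Qed.

(** Seen from w, each side of the rectangle contributes a positive imaginary
    part, namely the angle that it subtends. *)
Lemma winding_neq0 w : inner_rect a b c d w ->
  cauchy_transform (fun=> 1) w != 0.
Proof.
move=> wi; move: (wi) => [/andP[w1 w2] /andP[w3 w4]].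
have c1 z : rect_edge a b c d z -> cont (fun=> 1) z by move=> _;
  exact: cont_cst.
have [K1 K2 K3 K4] := edge_path_cont abW cdW (edge_kernel_cont wi c1).
have cReV (z : R[i]) : Re z^-1 = Re z / (Re z ^+ 2 + Im z ^+ 2) by case: z.
have cImV (z : R[i]) : Im z^-1 = - (Im z / (Re z ^+ 2 + Im z ^+ 2)) by case: z.
pose m := (d - Im w) / ((b - a) ^+ 2 + (d - Im w) ^+ 2).
have m0 : 0 < m.
  apply: divr_gt0; first by rewrite subr_gt0.
  by rewrite ltr_wpDl ?sqr_ge0// exprn_gt0// subr_gt0.
suff : 0 < Im (cauchy_transform (fun=> 1) w).
  by apply: contraTneq => ->; rewrite ltxx.
rewrite /cauchy_transform /rint cImD cImM /= mul0r add0r mul1r.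
apply: ltr_wpDr.
  rewrite -[X in X <= _](mul0r (d - c)); apply: Re_cint_ge => //.
    exact: path_contB.
  move=> t _; rewrite !mul1r cReB !cReV !cReB !cImB/=.
  rewrite subr_ge0 (@le_trans _ _ 0)//.
    apply: mulr_le0_ge0; first lra.
    by rewrite invr_ge0 addr_ge0// sqr_ge0.
  by apply: divr_ge0; [lra|rewrite addr_ge0// sqr_ge0].
apply: (@lt_le_trans _ _ (m * (b - a))); first by rewrite mulr_gt0// subr_gt0.
apply: Im_cint_ge => //; first exact: path_contB.
move=> t /andP[ta tb]; rewrite !mul1r cImB !cImV !cReB !cImB/= opprK addrC.
apply: ler_wpDr.
  rewrite oppr_ge0; apply: mulr_le0_ge0; first lra.
  by rewrite invr_ge0 addr_ge0// sqr_ge0.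
rewrite /m ler_pM2l ?subr_gt0// lef_pV2 ?posrE; last 2 first.
- by rewrite ltr_wpDl ?sqr_ge0// exprn_gt0// subr_gt0.
- by rewrite ltr_wpDl ?sqr_ge0// exprn_gt0// subr_gt0.
rewrite lerD2r -ler_sqrt ?sqr_ge0//
  !sqrtr_sqr (gtr0_norm (_ : 0 < b - a)) ?subr_gt0//.
by rewrite ler_norml; apply/andP; split; lra.
Qed.

Lemma expr_bound_le1 (x C : R) : 0 <= x -> (forall n : nat, x ^+ n <= C) ->
  x <= 1.
Proof.
move=> x0 xC; rewrite leNgt; apply/negP => x1.
have y1 : `|x^-1| < 1.
  by rewrite ger0_norm ?invr_ge0// invf_lt1// (lt_trans _ x1).
have C0 : 0 < C by rewrite (lt_le_trans _ (xC 0%N))// expr0.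
have Ci : 0 < C^-1 by rewrite invr_gt0.
have /cvgrPdist_lt/(_ _ Ci)[n _ /(_ n (leqnn n))] := cvg_expr y1.
have xp : 0 < x by rewrite (lt_trans _ x1).
rewrite sub0r normrN exprVn ger0_norm ?invr_ge0 ?exprn_ge0//.
by rewrite ltf_pV2 ?posrE ?exprn_gt0// ltNge xC.
Qed.

(** Cauchy's formula alone gives this bound up to a constant factor.  Applied to
    F ^+ n, it gives (|F w| / M) ^+ n bounded in n, hence |F w| <= M. *)
Theorem maximum_principle F w M : inner_rect a b c d w ->
  (forall z, rect a b c d z -> cdiff F z) ->
  (forall z, rect_edge a b c d z -> cabs (F z) <= M) -> cabs (F w) <= M.
Proof.
move=> wi Fd FM.
have M0 : 0 <= M.
  apply: le_trans (cabs_ge0 _) (FM (a +i* c)%C _).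
  by split; [split; rewrite /= lexx/= ltW|left].
wlog Mp : M FM M0 / 0 < M => [H|].
  apply/ler_addgt0Pr => e e0; apply: H;
    rewrite ?ltr_wpDl// ?addr_ge0 ?(ltW e0)//.
  by move=> z /FM; move=> /le_trans; apply; rewrite lerDl ltW.
have [r r0 rP] := edge_dist wi.
set N := cauchy_transform (fun=> 1) w.
have N0 : 0 < cabs N by rewrite cabs_gt0 winding_neq0.
have key n : cabs (F w) ^+ n * cabs N <= 4 * (M ^+ n / r) * ((b - a) + (d - c)).
  rewrite -cabsX -cabsM -(@cauchy_formula (fun z => F z ^+ n))//; last first.
    by move=> z /Fd; exact: cdiffX.
  apply: cauchy_transform_bound => // z ze.
    by case: ze => /Fd/(cdiffX n)/cdiff_cont.
  by rewrite cabsX lerXn2r ?nnegrE ?cabs_ge0// FM.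
suff : cabs (F w) / M <= 1 by rewrite ler_pdivrMr// mul1r.
apply: (@expr_bound_le1 _ (4 / r * ((b - a) + (d - c)) / cabs N)).
  by rewrite divr_ge0 ?cabs_ge0.
move=> n; rewrite expr_div_n ler_pdivrMr ?exprn_gt0// mulrAC ler_pdivlMr//.
by apply: le_trans (key n) _; rewrite le_eqVlt; apply/orP; left; apply/eqP;
  ring.
Qed.

(** Partial fractions: 1 / (z - u) = 1 / (z - p) + (u - p) / ((z - p) (z - u)).
    The difference quotient of a Cauchy transform is again one. *)
Lemma cauchy_transform_step F u p : inner_rect a b c d u ->
  inner_rect a b c d p ->
  (forall z, rect_edge a b c d z -> cont F z) ->
  cauchy_transform F u = cauchy_transform F p +
    (u - p) * cauchy_transform (fun z => F z * (z - p)^-1) u.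
Proof.
move=> ui pinn Fc; have Kp := edge_kernel_cont pinn Fc.
have Ku := edge_kernel_cont ui Kp.
rewrite /cauchy_transform -rintZ// -rintD//.
  apply: eq_rint => // z ze; have zu := edge_neq ui ze;
    have zp := edge_neq pinn ze.
  by field; rewrite !subr_eq0 zu zp.
by move=> z ze; apply: contM; [exact: cont_cst|exact: Ku].
Qed.

Lemma edge_bounded F : (forall z, rect_edge a b c d z -> cont F z) ->
  exists2 M : R, 0 < M & forall z, rect_edge a b c d z -> cabs (F z) <= M.
Proof.
move=> Fc; apply: cont_bound => //.
apply: (subclosed_compact _ (compact_rect (a:=a) (b:=b) (c:=c) (d:=d)));
  last first.
  by move=> z [].
have cl (f : R[i] -> R) x : continuous f -> closed [set z | f z = x].
  move=> fc; have -> : [set z | f z = x] = f @^-1` [set x] by [].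
  by apply: closed_comp => [z _|]; [exact: fc|exact: closed_eq].
have -> : rect_edge a b c d = [set z | rect a b c d z] `&`
   ([set z | Re z = a] `|` ([set z | Re z = b] `|`
   ([set z | Im z = c] `|` [set z | Im z = d]))) by [].
apply: closedI.
  by apply: compact_closed; [exact: C_hausdorff|exact: compact_rect].
apply: closedU; first by apply: cl; exact: Re_continuous.
apply: closedU; first by apply: cl; exact: Re_continuous.
by apply: closedU; apply: cl; exact: Im_continuous.
Qed.

Lemma inner_rect_ball p : inner_rect a b c d p ->
  exists2 r : R, 0 < r & forall u, cabs (u - p) < r ->
    inner_rect a b c d u /\ forall z, rect_edge a b c d z -> r <= cabs (z - u).
Proof.
move=> pinn; have [r r0 rP] := edge_dist pinn;
  move: (pinn) => [/andP[p1 p2] /andP[p3 p4]].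
pose e := Num.min (Num.min (Num.min (Re p - a) (b - Re p)) (Num.min (Im p - c)
  (d - Im p))) (r / 2).
have e0 : 0 < e by rewrite !lt_min !subr_gt0 p1 p2 p3 p4/= divr_gt0.
exists e => // u up; split.
  have := up; rewrite /e !lt_min => /andP[/andP[/andP[h1 h2] /andP[h3 h4]] _].
  have := Re_le_cabs (u - p); have := Im_le_cabs (u - p).
  rewrite cReB cImB => /ler_normlP[i1 i2] /ler_normlP[r1 r2].
  move: (cabs _) h1 h2 h3 h4 i1 i2 r1 r2 => x h1 h2 h3 h4 i1 i2 r1 r2.
  by clear -h1 h2 h3 h4 i1 i2 r1 r2; split; apply/andP; split; lra.
move=> z /rP zr; have := cabs_triangle u z p.
have er : e <= r / 2 by rewrite /e ge_min lexx orbT.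
by move: (cabs (z - p)) (cabs (z - u)) (cabs (u - p)) zr up => x y t;
  clear -er; lra.
Qed.

Lemma cauchy_transform_cont F p : inner_rect a b c d p ->
  (forall z, rect_edge a b c d z -> cont F z) -> cont (cauchy_transform F) p.
Proof.
move=> pinn Fc; have [r r0 rP] := inner_rect_ball pinn.
have Gc := edge_kernel_cont pinn Fc; have [M M0 MP] := edge_bounded Gc.
apply/contP => e e0.
pose B := 4 * (M / r) * ((b - a) + (d - c)).
have B0 : 0 < B.
  by rewrite mulr_gt0 ?mulr_gt0 ?invr_gt0// addr_gt0// subr_gt0.
exists (Num.min r (e / B)); first by rewrite lt_min r0 divr_gt0.
move=> u; rewrite lt_min => /andP[/rP[ui ur]].
rewrite ltr_pdivlMr//; apply: le_lt_trans.
rewrite (cauchy_transform_step ui pinn Fc) [X in cabs X]addrC addKr cabsM.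
rewrite ler_wpM2l ?cabs_ge0//.
exact: cauchy_transform_bound.
Qed.

Lemma cauchy_transform_cdiff F p : inner_rect a b c d p ->
  (forall z, rect_edge a b c d z -> cont F z) -> cdiff (cauchy_transform F) p.
Proof.
move=> pinn Fc; have [r r0 rP] := inner_rect_ball pinn.
have Gc := edge_kernel_cont pinn Fc.
apply: (cdiff_local r0 (cauchy_transform_cont pinn Gc)) => u /rP[ui _].
exact: cauchy_transform_step.
Qed.

(** With G = F - F p and H = G / (z - p), Cauchy's formula makes q the ratio of
    the Cauchy transforms of H and of 1, both differentiable at p. *)
Lemma quotient_cdiff_rect F q p : inner_rect a b c d p ->
  (forall z, rect a b c d z -> cdiff F z) -> cont q p ->
  (forall u, F u = F p + (u - p) * q u) -> cdiff q p.
Proof.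
move=> pinn Fd qp Fq; have [r r0 rP] := inner_rect_ball pinn.
pose G z := F z - F p.
have Gd z : rect a b c d z -> cdiff G z.
  by move=> /Fd Fz; apply: cdiffB => //; exact: cdiff_cst.
have Gc z : rect_edge a b c d z -> cont G z by move=> [/Gd/cdiff_cont].
have Hc := edge_kernel_cont pinn Gc.
have c1 z : rect_edge a b c d z -> cont (fun=> 1) z by move=> _;
  exact: cont_cst.
pose CH := cauchy_transform (fun z => G z * (z - p)^-1).
pose N := cauchy_transform (fun=> 1).
have E u : u != p -> cabs (u - p) < r -> CH u = q u * N u.
  move=> up /rP[ui _]; have u0 : u - p != 0 by rewrite subr_eq0.
  apply: (mulfI u0); rewrite -[LHS]add0r.
  have {1}<- : cauchy_transform G p = 0.
    by rewrite cauchy_formula// /G subrr mul0r.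
  rewrite -cauchy_transform_step// cauchy_formula// mulrA; congr (_ * _).
  by rewrite /G Fq [F p + _]addrC addrK.
have Np := winding_neq0 pinn.
have CHd := cauchy_transform_cdiff pinn Hc.
have Nd := cauchy_transform_cdiff pinn c1.
have Ep : CH p = q p * N p.
  apply: (@cont_unique _ (fun u => q u * N u) _ r) => //;
    first exact: cdiff_cont.
  by apply: contM => //; exact: cdiff_cont.
apply: (@cdiff_near _ (fun u => CH u * (N u)^-1) _ _ r) => //; last first.
  by apply: cdiffM => //; exact: cdiffV.
move=> u ur; have [ui _] := rP _ ur; have Nu := winding_neq0 ui.
by have [->|up] := eqVneq u p; rewrite ?Ep ?(E _ up ur) mulfK.
Qed.

End Kernel.

Definition square p (s : R) := rect (Re p - s) (Re p + s) (Im p - s) (Im p + s).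

Lemma square_ball p (s : R) z : square p s z -> cabs (z - p) <= 2 * s.
Proof.
move=> [/andP[z1 z2] /andP[z3 z4]]; apply: le_trans (cabs_le_ReIm _) _.
rewrite cReB cImB (_ : 2 * s = s + s); last by ring.
by apply: lerD; rewrite ler_norml; apply/andP; split; lra.
Qed.

Lemma inner_square p (s : R) : 0 < s ->
  inner_rect (Re p - s) (Re p + s) (Im p - s) (Im p + s) p.
Proof. by move=> s0; split; apply/andP; split; lra. Qed.

Lemma quotient_cdiff F q p (e : R) : 0 < e ->
  (forall z, cabs (z - p) < e -> cdiff F z) -> cont q p ->
  (forall u, F u = F p + (u - p) * q u) -> cdiff q p.
Proof.
move=> e0 Fd qp Fq; have s0 : 0 < e / 3 by rewrite divr_gt0.
apply: (quotient_cdiff_rect _ _ (inner_square p s0) _ qp Fq); [lra|lra|].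
by move=> z /square_ball zs; apply: Fd; apply: le_lt_trans zs _; lra.
Qed.

(** The function (z - p) F z is differentiable everywhere near p, and F is its
    Caratheodory quotient at p. *)
Theorem removable_singularity F p (e : R) : 0 < e -> cont F p ->
  (forall z, z != p -> cabs (z - p) < e -> cdiff F z) -> cdiff F p.
Proof.
move=> e0 Fp Fd; apply: (@quotient_cdiff (fun z => (z - p) * F z) F p e) => //;
  last first.
  by move=> u; rewrite subrr mul0r add0r.
move=> z ze; have [->|zp] := eqVneq z p.
  by exists F => // u; rewrite subrr mul0r add0r.
by apply: cdiffM; [exact: cdiff_subl|exact: Fd].
Qed.

End CauchyFormula.

(** * Injective holomorphic functions *)

Section UnivalentFunctions.
Context {R : realType}.
Implicit Types (z w u p : R[i]) (F f g h q : R[i] -> R[i]) (U : set R[i]).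
Local Notation Re := (@complex.Re R).
Local Notation Im := (@complex.Im R).

(** If every order of vanishing were exceeded, then F = (u - p) ^+ n * h for all n
    with h holomorphic, and the maximum principle for h on a square of
    half-side s would give |F w| <= M |w - p| ^+ n / s ^+ n for all n, so F would
    vanish at points w close to p. *)
Lemma zero_order F p (e : R) : 0 < e ->
  (forall u, cabs (u - p) < e -> cdiff F u) -> F p = 0 ->
  (forall u, cabs (u - p) < e -> u != p -> F u != 0) ->
  exists n h, [/\ forall u, F u = (u - p) ^+ n.+1 * h u, h p != 0 &
                  forall u, cabs (u - p) < e -> cdiff h u].
Proof.
move=> e0 Fd Fp F0; apply: contrapT => noorder.
have allorders n : exists2 h, forall u, F u = (u - p) ^+ n * h u &
    forall u, cabs (u - p) < e -> cdiff h u.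
  elim: n => [|n [h Fh hd]]; first by exists F => // u; rewrite expr0 mul1r.
  have hp0 : h p = 0.
    case: n => [|n] in Fh *; first by have := Fh p; rewrite Fp expr0 mul1r.
    by apply: contrapT => /eqP hp; apply: noorder; exists n, h.
  have [|q qp hq] := hd p; first by rewrite subrr cabs0.
  exists q => u; first by rewrite Fh hq hp0 add0r mulrA -exprSr.
  move=> ue; have [->|up] := eqVneq u p;
    first exact: quotient_cdiff e0 hd qp hq.
  by apply: cdiff_quotient up _ hq; exact: hd.
(* points of the square of half-side s are at distance at most 2 s < e from p *)
pose s := e / 3; have s0 : 0 < s by rewrite divr_gt0.
have sd h : (forall u, cabs (u - p) < e -> cdiff h u) ->
    forall z, square p s z -> cdiff h z.
  by move=> hd z /square_ball zs; apply: hd; apply: le_lt_trans zs _;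
    rewrite /s; lra.
have sx : Re p - s < Re p + s by lra.
have sy : Im p - s < Im p + s by lra.
have [|M M0 MP] := @edge_bounded _ (Re p - s) (Re p + s) (Im p - s) (Im p + s)
  F.
  by move=> z [/(sd _ Fd)/cdiff_cont].
pose w := p + (s / 2)%:C%C.
have wp : cabs (w - p) = s / 2.
  by rewrite /w addrC addKr cabs_real ger0_norm// ltW// divr_gt0.
have Fw : 0 < cabs (F w).
  rewrite cabs_gt0; apply: F0; first by rewrite wp /s; lra.
  by rewrite -subr_eq0 -cabs_eq0 wp gt_eqF// divr_gt0.
have wi : inner_rect (Re p - s) (Re p + s) (Im p - s) (Im p + s) w.
  by split; rewrite /w ?cReD ?cImD/=; apply/andP; split; lra.
suff : (2 : R) <= 1 by lra.
apply: (@expr_bound_le1 _ _ (M / cabs (F w))) => // n.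
have [h Fh hd] := allorders n.
have : cabs (h w) <= M / s ^+ n.
  apply: (maximum_principle sx sy wi (sd _ hd)) => z ze.
  rewrite ler_pdivlMr ?exprn_gt0//; apply: le_trans (MP _ ze).
  rewrite Fh mulrC cabsM cabsX ler_wpM2r ?cabs_ge0//
    lerXn2r ?nnegrE ?cabs_ge0 ?(ltW s0)//.
  have := Re_le_cabs (z - p); have := Im_le_cabs (z - p).
  rewrite cReB cImB => /ler_normlP[i1 i2] /ler_normlP[r1 r2].
  case: ze => _ [E|[E|[E|E]]]; rewrite {}E in i1 i2 r1 r2;
    move: (cabs _) i1 i2 r1 r2 => x;
    clear; lra.
rewrite ler_pdivlMr ?exprn_gt0// ler_pdivlMr//; apply: le_trans.
rewrite Fh cabsM cabsX wp expr_div_n le_eqVlt; apply/orP; left; apply/eqP.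
by field; rewrite expf_neq0.
Qed.

Lemma power_quotient (n : nat) u p : exists q, [/\ cont q u,
  forall z, (z - p) ^+ n = (u - p) ^+ n + (z - u) * q z &
  q u = n%:R * (u - p) ^+ n.-1].
Proof.
elim: n => [|n [q [qu qE quE]]].
  by exists (fun=> 0); split; [exact: cont_cst|move=> z; rewrite !expr0;
    ring|rewrite mul0r].
exists (fun z => (z - p) * q z + (u - p) ^+ n); split.
- by apply: contD; [apply: contM => //; exact: cont_subl|exact: cont_cst].
- by move=> z; rewrite !exprS qE; ring.
- rewrite quE /=; case: n {qu qE quE} => [|n]; first by rewrite expr0; ring.
  by rewrite /= exprS -(natr1 n.+1); ring.
Qed.

(** A uniform bound for the derivatives near p: the quotient q is holomorphic on
    a square, so it is bounded by its values on the edge, where its denominator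
    z - u is at least r. *)
Lemma cauchy_estimate h p (e : R) : 0 < e ->
  (forall u, cabs (u - p) < e -> cdiff h u) ->
  exists r L : R, [/\ 0 < r, 0 < L & forall u q, cabs (u - p) < r -> cont q u ->
    (forall z, h z = h u + (z - u) * q z) -> cabs (q u) <= L].
Proof.
move=> e0 hd; pose s := e / 3; have s0 : 0 < s by rewrite divr_gt0.
have se z : square p s z -> cabs (z - p) < e.
  by move=> /square_ball zs; apply: le_lt_trans zs _; rewrite /s; lra.
have sx : Re p - s < Re p + s by lra.
have sy : Im p - s < Im p + s by lra.
have [|M M0 MP] := @cont_bound _ h (square p s) (compact_rect (a:=_) (b:=_)
  (c:=_) (d:=_)).
  by move=> z /se/hd/cdiff_cont.
have [r r0 rP] := inner_rect_ball (inner_square p s0).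
exists r, ((M + M) / r); split => //; first by rewrite divr_gt0// addr_gt0.
move=> u q /rP[ui ur] qu hq.
have us := inner_rectW ui.
apply: (maximum_principle sx sy ui).
  move=> z zs; have [->|zu] := eqVneq z u;
    last exact: cdiff_quotient zu (hd _ (se _ zs)) hq.
  have d0 : 0 < e - cabs (u - p) by rewrite subr_gt0 se.
  apply: (quotient_cdiff d0 _ qu hq) => v vu; apply: hd.
  by apply: le_lt_trans (cabs_triangle u _ _) _; move: vu; clear; lra.
move=> z ze; rewrite ler_pdivlMr//.
apply: (@le_trans _ _ (cabs (h z - h u))).
  by rewrite (hq z) [X in _ <= cabs X]addrC addKr cabsM mulrC ler_wpM2r
    ?cabs_ge0// ur.
by apply: le_trans (cabsD _ _) _; rewrite cabsN lerD// MP//; case: ze.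
Qed.

Section Univalent.
Variables (U : set R[i]) (f : R[i] -> R[i]).
Hypotheses (Uo : open U) (fd : forall z, U z -> cdiff f z) (finj : set_inj U f).

(** If f omitted a value w close to f p, then 1 / (f - w) would be holomorphic on
    a square around p and larger at p than on the edge. *)
Lemma open_mapping p (e : R) : U p -> 0 < e -> exists2 m : R, 0 < m &
  forall w, cabs (w - f p) < m -> exists u, [/\ U u, cabs (u - p) < e &
    f u = w].
Proof.
move=> Up e0; have [d d0 dU] := (open_cabs U).1 Uo p Up.
pose s := Num.min d e / 3; have m0 : 0 < Num.min d e by rewrite lt_min d0.
have s0 : 0 < s by rewrite divr_gt0.
have sP z : square p s z -> U z /\ cabs (z - p) < e.
  move=> /square_ball zs; have : cabs (z - p) < Num.min d e.
    by apply: le_lt_trans zs _; rewrite /s; lra.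
  by rewrite lt_min => /andP[/dU].
have sx : Re p - s < Re p + s by lra.
have sy : Im p - s < Im p + s by lra.
have pin := inner_square p s0.
have fne z : rect_edge (Re p - s) (Re p + s) (Im p - s) (Im p + s) z ->
  f z - f p != 0.
  move=> ze; rewrite subr_eq0; apply/negP => /eqP /finj E.
  have := edge_neq pin ze; rewrite E ?eqxx//; apply: mem_set => //.
  by case: ze => /sP[].
have [|M M0 MP] := @edge_bounded _ (Re p - s) (Re p + s) (Im p - s) (Im p + s)
  (fun z => (f z - f p)^-1).
  move=> z ze; apply: contV; first exact: fne.
  apply: contB; last exact: cont_cst.
  by case: ze => /sP[/fd/cdiff_cont].
(* on the edge f stays at least M^-1 away from f p *)
exists (2 * M)^-1; first by rewrite invr_gt0 mulr_gt0.
move=> w wf; apply: contrapT => nw.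
have nz z : square p s z -> f z - w != 0.
  move=> /sP[Uz ze]; rewrite subr_eq0; apply/negP => /eqP fz.
  by apply: nw; exists z.
have pn : f p - w != 0 by apply: nz; exact: inner_rectW.
have : cabs (f p - w)^-1 <= 2 * M.
  apply: (maximum_principle sx sy (F := fun z => (f z - w)^-1) pin).
    move=> z zs; apply: cdiffV; first exact: nz.
    by apply: cdiffB; [by have [/fd] := sP _ zs|exact: cdiff_cst].
  move=> z ze; rewrite cabsV -[X in _ <= X]invrK lef_pV2 ?posrE.
  - have := MP _ ze; rewrite cabsV -[X in _ <= X]invrK lef_pV2 ?posrE
    ?invr_gt0//; last first.
      by rewrite cabs_gt0 fne.
    have := cabs_triangle w (f z) (f p).
    have -> : M^-1 = (2 * M)^-1 + (2 * M)^-1 by field; rewrite gt_eqF.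
    move: wf; move: (cabs _) (cabs _) (cabs _) (2 * M)^-1 => x y t v; lra.
  - by rewrite cabs_gt0 nz//; case: ze.
  - by rewrite invr_gt0 mulr_gt0.
rewrite cabsV -[X in _ <= X]invrK lef_pV2 ?posrE ?invr_gt0 ?mulr_gt0//;
  last by rewrite cabs_gt0.
by rewrite cabsC leNgt wf.
Qed.

Lemma univalent_image_open V : V `<=` U -> open V -> open (f @` V).
Proof.
move=> VU /open_cabs Vo; apply/open_cabs => _ [p Vp <-].
have [e e0 eP] := Vo p Vp; have [m m0 mP] := open_mapping (VU _ Vp) e0.
by exists m => // w /mP[u [_ /eP Vu <-]]; exists u.
Qed.

(** With f z - f p = (z - p) ^+ n.+1 * h z, the derivative at u is
    (u - p) ^+ n times (n.+1) h u + (u - p) h' u.  The first term stays away from 0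
    near p and the second one tends to 0, as h' is bounded. *)
Lemma critical_isolated p : U p -> exists2 e : R, 0 < e &
  forall u q, u != p -> cabs (u - p) < e -> cont q u ->
    (forall z, f z = f u + (z - u) * q z) -> q u != 0.
Proof.
move=> Up; have [e e0 eU] := (open_cabs U).1 Uo p Up.
have [||||n [h [Fh hp hd]]] := @zero_order (fun z => f z - f p) p e => //.
- by move=> u /eU/fd fu; apply: cdiffB => //; exact: cdiff_cst.
- by rewrite subrr.
- move=> u /eU Uu; apply: contraNN; rewrite subr_eq0 => /eqP/finj -> //;
  exact: mem_set.
have [r [L [r0 L0 rL]]] := cauchy_estimate e0 hd.
have hp0 : 0 < cabs (h p) by rewrite cabs_gt0.
have hcont : cont h p by apply/cdiff_cont/hd; rewrite subrr cabs0.
have [|hc hc0 hcP] := (contP h p).1 hcont (cabs (h p) / 2);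
  first by rewrite divr_gt0.
pose d := Num.min (Num.min e r) (Num.min hc (cabs (h p) / 2 / L)).
exists d; first by rewrite !lt_min e0 r0 hc0 !divr_gt0.
move=> u q up; rewrite !lt_min => /andP[/andP[ue ur] /andP[uh uL]] qu fq.
have hu : cabs (h p) / 2 < cabs (h u).
  have := hcP _ uh; have := cabs_triangle (h u) (h p) 0;
    rewrite !subr0 (cabsC (h p)).
  move: (cabs _) (cabs _) (cabs _) => x y t; lra.
have [g gu hg] := hd u ue.
have gL := rL u g ur gu hg.
have [S [Su SE SuE]] := power_quotient n.+1 u p.
have qE : q u = S u * h u + (u - p) ^+ n.+1 * g u.
  apply: (@cont_unique _ q (fun z => S z * h z + (u - p) ^+ n.+1 * g z) u 1) =>
    //.
    apply: contD; first by apply: contM => //; exact/cdiff_cont/hd.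
    by apply: contM => //; exact: cont_cst.
  move=> z zu _; have zu0 : z - u != 0 by rewrite subr_eq0.
  apply: (mulfI zu0); transitivity (f z - f u); first by rewrite fq; ring.
  transitivity ((f z - f p) - (f u - f p)); first by ring.
  by rewrite !Fh SE (hg z); ring.
have up0 : u - p != 0 by rewrite subr_eq0.
have -> : q u = (u - p) ^+ n * (n.+1%:R * h u + (u - p) * g u).
  by rewrite qE SuE exprS /=; ring.
rewrite mulf_neq0 ?expf_neq0//; apply/negP;
  rewrite addr_eq0 => /eqP/(congr1 cabs).
rewrite cabsN !cabsM cabs_nat => E.
have h1 : cabs (h u) <= n.+1%:R * cabs (h u).
  by rewrite ler_peMl ?cabs_ge0// ler1n.
have h2 : cabs (u - p) * cabs (g u) <= cabs (h p) / 2.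
  apply: (@le_trans _ _ (cabs (u - p) * L));
    first by rewrite ler_wpM2l ?cabs_ge0.
  by rewrite -ler_pdivlMr// ltW.
by move: (le_lt_trans (le_trans h1 (eq_ind_r (fun x => x <= _) h2 E)) hu);
  rewrite ltxx.
Qed.

Variable g : R[i] -> R[i].
Hypothesis gK : forall u, U u -> g (f u) = u.

Lemma inverse_cont p : U p -> cont g (f p).
Proof.
move=> Up; apply/contP => e e0; have [m m0 mP] := open_mapping Up e0.
by exists m => // w /mP[u [Uu ue <-]]; rewrite !gK.
Qed.

(** The inverse g is differentiable at the images of the non-critical points by
    the usual inverse rule; the image of an isolated critical point is a
    removable singularity, since g is continuous there. *)
Theorem inverse_cdiff p : U p -> cdiff g (f p).
Proof.
have regular u q : U u -> cont q u -> (forall z, f z = f u + (z - u) * q z) ->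
    q u != 0 -> cdiff g (f u).
  move=> Uu qu fq qu0; have gc := inverse_cont Uu.
  have qgc : cont (q \o g) (f u) by apply: cont_comp => //; rewrite gK.
  have [|d d0 dP] := cont_neq0 qgc; first by rewrite /= gK.
  have [m m0 mP] := open_mapping Uu ltr01.
  apply: (@cdiff_local _ _ (fun w => ((q \o g) w)^-1) _ (Num.min d m)).
  - by rewrite lt_min d0.
  - by apply: contV => //=; rewrite gK.
  move=> w; rewrite lt_min => /andP[/dP /= qw0 /mP[z [Uz _ fz]]].
  by move: qw0; rewrite -fz !gK// => qz0; rewrite fq; field.
move=> Up; have [e e0 eP] := critical_isolated Up.
have [m m0 mP] := open_mapping Up e0.
apply: (removable_singularity m0 (inverse_cont Up)) => w wp /mP[u [Uu ue E]].
have [q qu fq] := fd Uu; rewrite -E; apply: (regular _ q) => //.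
by apply: eP fq => //; apply: contraNneq wp => <-; rewrite E.
Qed.

End Univalent.

End UnivalentFunctions.

(** * Images of round annuli *)

Section PlaneTopology.
Context {R : realType}.
Implicit Types (z w u p v : R[i]) (f g : R[i] -> R[i]) (A B C U : set R[i]).
Implicit Types (r s t : R).

Lemma connected_image f A : connected A -> (forall z, A z -> cont f z) ->
  connected (f @` A).
Proof.
move=> cA fc; apply: connected_continuous_connected => //.
by apply: continuous_in_subspaceT => z /set_mem/fc/cont_cvg.
Qed.

Lemma compact_image f A : compact A -> (forall z, A z -> cont f z) ->
  compact (f @` A).
Proof.
move=> cA fc; apply: continuous_compact => //.
by apply: continuous_in_subspaceT => z /set_mem/fc/cont_cvg.
Qed.

Lemma compact_closedC A : compact A -> closed A.
Proof. by apply: compact_closed; exact: C_hausdorff. Qed.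

Lemma line_continuous z w : continuous (fun t : R => z + t%:C%C * (w - z)).
Proof.
move=> t; apply/(@cvg_cabs _ _ (nbhs t) _ _ _) => e e0.
have c0 : 0 < cabs (w - z) + 1 by have := cabs_ge0 (w - z); lra.
apply/nbhs_ballP; exists (e / (cabs (w - z) + 1)); first by rewrite /= divr_gt0.
move=> x; rewrite /ball/= distrC ltr_pdivlMr// => tx.
have -> : z + x%:C%C * (w - z) - (z + t%:C%C * (w - z)) = (x - t)%:C%C * (w -
  z).
  by rewrite rmorphB; ring.
rewrite cabsM cabs_real; apply: le_lt_trans tx.
by rewrite ler_wpM2l// lerDl.
Qed.

Definition segment z w := (fun t : R => z + t%:C%C * (w - z)) @` `[0, 1].

Lemma line_segment_connected z w (a b : R) :
  connected ((fun t : R => z + t%:C%C * (w - z)) @` `[a, b]).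
Proof.
apply: connected_continuous_connected; first exact: segment_connected.
by apply: continuous_subspaceT; exact: line_continuous.
Qed.

Lemma segmentl z w : segment z w z.
Proof. by exists 0; rewrite /= ?in_itv/= ?lexx ?ler01//
  rmorph0 mul0r addr0. Qed.

Lemma segmentr z w : segment z w w.
Proof.
by exists 1; rewrite /= ?in_itv/= ?lexx ?ler01// rmorph1 mul1r addrC subrK.
Qed.

Lemma star_connected A p : (forall z, A z -> segment p z `<=` A) -> connected A.
Proof.
move=> Ap; have [->|A0] := eqVneq A set0; first exact: connected0.
have -> : A = \bigcup_(z in A) segment p z.
  rewrite eqEsubset; split=> [z Az|z [w Aw]]; last exact: Ap.
  by exists z => //; exact: segmentr.
apply: bigcup_connected; first by exists p => z _; exact: segmentl.
by move=> z _; exact: line_segment_connected.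
Qed.

Lemma segment_cabs p z v : segment p z v -> cabs (v - p) <= cabs (z - p).
Proof.
move=> [t /=]; rewrite in_itv/= => /andP[t0 t1] <-.
by rewrite addrC addKr cabsM cabs_real ger0_norm// ler_piMl// cabs_ge0.
Qed.

Lemma closed_disc_connected p r : connected [set z | cabs (z - p) <= r].
Proof.
apply: (star_connected (p := p)) => z /= zr v /segment_cabs; move/le_trans;
  exact.
Qed.

(** The angle of a point of the circle is plus or minus the arccosine of its
    abscissa. *)
Lemma circle_connected p r : 0 < r -> connected [set z | cabs (z - p) = r].
Proof.
move=> r0; pose c (t : R) : R[i] := p + r%:C%C * (cos t +i* sin t)%C.
have cc : continuous c.
  move=> t.
  have H : (fun t : R => (cos t +i* sin t)%C) @ t --> (cos t +i* sin t)%C.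
    by apply: cvg_ReIm; [exact: continuous_cos|exact: continuous_sin].
  apply: (@cvg_comp _ _ _ (fun t : R => (cos t +i* sin t)%C)
    (fun z => p + r%:C%C * z) (nbhs t) _ _ H).
  apply: cont_cvg; apply: contD; first exact: cont_cst.
  by apply: contM; [exact: cont_cst|exact: cont_id].
have -> : [set z | cabs (z - p) = r] = c @` `[- pi, pi].
  rewrite eqEsubset; split=> [z /= zr|_ [t _ <-]] /=; last first.
    rewrite /c addrC addKr cabsM cabs_real cabsE/= cos2Dsin2 sqrtr1 mulr1.
    by rewrite gtr0_norm.
  pose x := complex.Re (z - p) / r; pose y := complex.Im (z - p) / r.
  have xy : x ^+ 2 + y ^+ 2 = 1.
    rewrite /x /y !expr_div_n -mulrDl -[X in X /
      _]sqr_sqrtr ?addr_ge0 ?sqr_ge0//.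
    by rewrite -cabsE zr divff// expf_neq0// gt_eqF.
  have x1 : -1 <= x <= 1.
    rewrite -ler_norml -(@ler_pXn2r _ 2) ?nnegrE ?normr_ge0//.
    by rewrite real_normK ?num_real// expr1n -xy lerDl sqr_ge0.
  have zE : z = p + r%:C%C * (x +i* y)%C.
    have rn : r != 0 by rewrite gt_eqF.
    have [Ex Ey] : r * x = complex.Re (z - p) /\ r * y = complex.Im (z - p).
      by rewrite /x /y !mulrA !(mulrC r) !mulfK.
    apply: complex_eqP.
      by rewrite cReD cReM/= mul0r subr0 Ex cReB addrC subrK.
    by rewrite cImD cImM/= mul0r addr0 Ey cImB addrC subrK.
  have cosE := acosK (_ : x \in `[(-1), 1]); rewrite in_itv/= in cosE.
  have sinE : sin (acos x) = `|y|.
    by rewrite sin_acos// -xy addrC addKr sqrtr_sqr.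
  have [y0|y0] := leP 0 y.
    exists (acos x); first by rewrite /= in_itv/= acos_lepi// andbT
      (le_trans _ (acos_ge0 x1))// oppr_le0 pi_ge0.
    by rewrite zE /c cosE// sinE ger0_norm.
  exists (- acos x); first by rewrite /= in_itv/= lerN2 acos_lepi//=
    (@le_trans _ _ 0) ?pi_ge0// oppr_le0 acos_ge0.
  by rewrite zE /c cosN sinN cosE// sinE ltr0_norm// opprK.
apply: connected_continuous_connected; first exact: segment_connected.
exact: continuous_subspaceT.
Qed.

(** The circles of the annulus all meet one radius. *)
Lemma round_annulus_connected p r s : 0 < r -> connected (round_annulus p r s).
Proof.
move=> r0; have [sr|rs] := leP s r.
  rewrite (_ : round_annulus p r s = set0); first exact: connected0.
  by rewrite -subset0 => z /= /andP[/lt_trans h /h]; rewrite ltNge sr.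
pose ray := [set p + t%:C%C | t in `]r, s[].
have rayP t : r < t < s -> cdist (p + t%:C%C) p = t.
  move=> /andP[rt _].
  by rewrite cdistE addrC addKr cabs_real gtr0_norm// (lt_trans r0).
have rayc : connected ray.
  apply: connected_continuous_connected.
    by apply/connected_intervalP; exact: interval_is_interval.
  apply: continuous_subspaceT => t.
  rewrite (_ : (fun t : R => p + t%:C%C) = (fun t =>
    p + t%:C%C * ((p + 1) - p))).
    exact: line_continuous.
  by apply/funext => x; rewrite (addrC p 1) addrK mulr1.
pose m := (r + s) / 2; have rms : r < m < s by rewrite /m; apply/andP; split;
  lra.
have -> : round_annulus p r s =
    \bigcup_(t in `]r, s[) ([set z | cabs (z - p) = t] `|` ray).
  rewrite eqEsubset; split=> [z zrs|z [t /=]].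
    by exists (cdist z p); [rewrite /= in_itv|left].
  rewrite in_itv/= => trs [/= zt|[x /=]].
    by rewrite /round_annulus/= cdistE zt.
  by rewrite in_itv/= => xrs <-; rewrite /round_annulus/= rayP.
apply: bigcup_connected.
  by exists (p + m%:C%C) => t _; right; exists m; rewrite //= in_itv.
move=> t; rewrite /= in_itv/= => trs; apply: connectedU => //.
  exists (p + t%:C%C); split => /=; last by exists t; rewrite //= in_itv.
  exact: rayP.
by apply: circle_connected; case/andP: trs => /(lt_trans r0).
Qed.

Lemma round_annulus_open p r s : open (round_annulus p r s).
Proof.
apply/open_cabs => z /andP[rz zs].
exists (Num.min (cdist z p - r) (s - cdist z p));
  first by rewrite lt_min !subr_gt0 rz.
move=> u; rewrite lt_min => /andP[]; rewrite /round_annulus/= !cdistE.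
have := cabs_triangle u z p; have := cabs_triangle z u p; rewrite (cabsC z u).
by move: (cabs _) (cabs _) (cabs _) => x y t *; apply/andP; split; lra.
Qed.

Lemma disc_open p r : open [set z | cabs (z - p) < r].
Proof.
apply/open_cabs => z /= zr; exists (r - cabs (z - p));
  first by rewrite subr_gt0.
move=> u; have := cabs_triangle z u p.
by move: (cabs _) (cabs _) (cabs _) => x y t *; lra.
Qed.

Lemma first_hit (K : set R[i]) z w : closed K -> K w ->
  exists t : R, [/\ 0 <= t <= 1, K (z + t%:C%C * (w - z)) &
    forall x, 0 <= x < t -> ~ K (z + x%:C%C * (w - z))].
Proof.
move=> cK Kw; pose l (t : R) := z + t%:C%C * (w - z).
pose S : set R := `[0, 1] `&` l @^-1` K.
have Sc : compact S.
  apply: (subclosed_compact _ (@segment_compact _ 0 1)); last by move=> t [].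
  apply: closedI; first exact: interval_closed.
  by apply: closed_comp => // t _; exact: line_continuous.
have [||t /set_mem[t01 Kt] tmin] := @compact_EVT_min _ R id S _ Sc.
- exists 1; split; first by rewrite /= in_itv/= lexx ler01.
  by rewrite /l /= rmorph1 mul1r addrC subrK.
- by apply: continuous_subspaceT => t; exact: cvg_id.
move: t01; rewrite /= in_itv/= => t01; exists t; split => // x /andP[x0 xt] Kx.
have : S x.
  split => //; rewrite /= in_itv/= x0/= (le_trans (ltW xt))//.
  by case/andP: t01.
by move=> /mem_set/tmin; rewrite leNgt xt.
Qed.

(** From any point v outside f (disc), walk straight towards f p.  The first
    point of the path in f (closed disc) is not in f (disc), which is open, so it
    is on the connected curve f (circle); until then the path stays outside.
    So every v is joined to that curve. *)
Lemma outer_connected f p r : 0 < r ->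
  (forall z, cabs (z - p) <= r -> cont f z) ->
  set_inj [set z | cabs (z - p) <= r] f ->
  open (f @` [set z | cabs (z - p) < r]) ->
  connected (~` (f @` [set z | cabs (z - p) < r])).
Proof.
move=> r0 fc fi; set O := f @` _ => Oo.
pose K := f @` [set z | cabs (z - p) <= r].
pose G := f @` [set z | cabs (z - p) = r].
have cK : closed K.
  apply: compact_closedC; apply: compact_image => //;
    exact: closed_disc_compact.
have OK : O `<=` K by apply: image_subset => z /= /ltW.
have KG v : K v -> ~ O v -> G v.
  move=> [z /= zr fz] nO; exists z => //=; apply/eqP; rewrite eq_le zr leNgt/=.
  by apply/negP => zlt; apply: nO; exists z.
have GO : G `<=` ~` O.
  move=> _ [z /= zr <-] [u /= ur] /fi E.
  have uz : u = z by apply: E; apply: mem_set; rewrite /= ?zr // ltW.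
  by move: ur; rewrite uz zr ltxx.
have Gc : connected G.
  apply: connected_image; first exact: circle_connected.
  by move=> z /= zr; apply: fc; rewrite zr.
have Kp : K (f p) by exists p => //=; rewrite subrr cabs0 ltW.
pose l v (t : R) := v + t%:C%C * (f p - v).
have path v : ~ O v -> exists T, [/\ T v, T `<=` ~` O, (T `&` G) !=set0 &
  connected T].
  move=> nOv; have [t [/andP[t0 t1] Kt tmin]] := first_hit v cK Kp.
  have nOt : ~ O (l v t).
    move=> Ot; have [t00|tn0] := eqVneq t 0.
      by apply: nOv; move: Ot; rewrite /l t00 rmorph0 mul0r addr0.
    have tp : 0 < t by rewrite lt_def tn0.
    have /nbhs_ballP[e /= e0 eO] : nbhs t (l v @^-1` O).
      by apply: line_continuous; exact: open_nbhs_nbhs.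
    pose x := Num.max (t / 2) (t - e / 2).
    have xt : x < t by rewrite gt_max; apply/andP; split; lra.
    have x0 : 0 <= x by rewrite le_max; apply/orP; left; lra.
    apply: (tmin x); first by rewrite x0.
    apply: OK; apply: eO; rewrite /ball/= gtr0_norm ?subr_gt0//.
    have : t - e / 2 <= x by rewrite le_max lexx orbT.
    by lra.
  exists (l v @` `[0, t]); split.
  - by exists 0; rewrite /= ?in_itv/= ?lexx// /l rmorph0 mul0r addr0.
  - move=> w [x /=]; rewrite in_itv/= => /andP[x0];
    rewrite le_eqVlt => /orP[/eqP xt <-|xt <-].
      by rewrite xt.
    by move=> /OK; apply: tmin; rewrite x0.
  - by exists (l v t); split; [exists t;
    rewrite //= in_itv/= t0 lexx|exact: KG].
  - exact: line_segment_connected.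
have {}path v : exists T, ~ O v ->
    [/\ T v, T `<=` ~` O, (T `&` G) !=set0 & connected T].
  by have [/path[T TP]|nv] := pselect (~ O v); [exists T|exists set0].
have [T TP] := choice path.
have -> : ~` O = \bigcup_(v in ~` O) (T v `|` G).
  rewrite eqEsubset; split=> [v Ov|v [u /TP[_ TO _ _]]].
    by exists v => //; left; have [] := TP v Ov.
  by case=> [/TO|/GO].
apply: bigcup_connected.
  exists (f (p + r%:C%C)) => v _; right; exists (p + r%:C%C) => //=.
  by rewrite addrC addKr cabs_real gtr0_norm.
by move=> v /TP[_ _ TG Tc]; exact: connectedU.
Qed.

Section TwoComponents.
Variables (I O : set R[i]).
Hypotheses (Ic : closed I) (Oc : closed O) (IO : I `&` O = set0).
Hypotheses (Icon : connected I) (Ocon : connected O).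

Lemma closed_separated : separated I O.
Proof. by split; rewrite -((closure_id _).1 _). Qed.

Lemma component_left z : I z -> connected_component (I `|` O) z = I.
Proof.
move=> Iz; apply/seteqP; split; last first.
  by apply: connected_component_max => //; left.
have [H|H] := connected_subset closed_separated
  (@connected_component_sub _ (I `|` O) z) (@component_connected _ _ _).
  exact: H.
suff : (set0 : set R[i]) z by [].
by rewrite -IO; split => //; apply: H; apply: connected_component_refl; left.
Qed.

End TwoComponents.

Lemma two_components (I O : set R[i]) : closed I -> closed O ->
  I `&` O = set0 ->
  connected I -> connected O -> I !=set0 -> O !=set0 ->
  components (I `|` O) = [set I; O].
Proof.
move=> Ic Oc IO Icon Ocon [x Ix] [y Oy].
have CI := component_left Ic Oc IO Icon.
have CO := @component_left O I Oc Ic _ Ocon; rewrite setIC setUC in CO.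
rewrite eqEsubset; split=> [_ [z [Iz|Oz] <-]|C [->|->]].
- by left; exact: CI.
- by right; exact: CO.
- by exists x; [left|exact: CI].
- by exists y; [right|exact: CO].
Qed.

Lemma card_set2 (T : Type) (x y : T) : x <> y -> ([set x; y] #= `I_2)%card.
Proof.
move=> xy; pose h (n : nat) := if n == 0%N then x else y.
have -> : [set x; y] = h @` `I_2.
  rewrite eqEsubset; split=> [_ [->|->]|_ [[|[|n]] // _ <-]].
  - by exists 0%N.
  - by exists 1%N.
  - by left.
  - by right.
apply: inj_card_eq => -[|[|m]] [|[|n]]; rewrite ?inE// /h/= => _ _ E //.
by case: xy.
Qed.

(** The image of a round annulus whose outer closed disc is in the domain.  Its
    complement is the disjoint union of two connected closed sets: the image of
    the inner closed disc, and the complement of the image of the outer disc. *)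
Theorem univalent_annulus U f p r s : open U -> (forall z, U z -> cdiff f z) ->
  set_inj U f -> 0 < r -> r < s -> (forall z, cabs (z - p) <= s -> U z) ->
  let A := f @` round_annulus p r s in
  let I := f @` [set z | cabs (z - p) <= r] in
  let O := ~` (f @` [set z | cabs (z - p) < s]) in
  [/\ has_modulus A (ln (s / r)), components (~` A) = [set I; O] &
      forall z, I z -> connected_component (~` A) z = I].
Proof.
move=> Uo fd fi r0 rs dU A I O; have s0 := lt_trans r0 rs.
have fc z : cabs (z - p) <= s -> cont f z by move/dU/fd/cdiff_cont.
have finj z u : U z -> U u -> f z = f u -> z = u.
  by move=> Uz Uu /fi; apply; exact: mem_set.
have Do : open (f @` [set z | cabs (z - p) < s]).
  by apply: (univalent_image_open Uo fd fi _ (@disc_open p s)) => z /ltW/dU.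
have AU : round_annulus p r s `<=` U.
  by move=> z /andP[_ /ltW]; rewrite cdistE => /dU.
have AE : ~` A = I `|` O.
  rewrite eqEsubset; split=> [w nA|w [[z /= zr <-]|nD]].
  - have [[z /= zs fz]|] := pselect ((f @` [set z | cabs (z - p) < s]) w);
    last by right.
    left; exists z => //=; rewrite leNgt; apply/negP => rz; apply: nA.
    by exists z => //; apply/andP.
  - move=> [u /andP[]]; rewrite !cdistE => ur us /finj E.
    have uz : u = z by apply: E; apply: dU;
      [exact: ltW|exact: (le_trans zr (ltW rs))].
    by move: ur; rewrite uz ltNge zr.
  - by move=> [u /andP[_ us] fu]; apply: nD; exists u.
have Icl : closed I.
  apply: compact_closedC; apply: compact_image;
    first exact: closed_disc_compact.
  by move=> z /= zr; apply: fc; exact: le_trans (ltW rs).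
have Ocl : closed O by exact: open_closedC.
have IO : I `&` O = set0.
  rewrite -subset0 => _ [[z /= zr <-]]; apply; exists z => //=.
  exact: le_lt_trans rs.
have Icon : connected I.
  apply: connected_image; first exact: closed_disc_connected.
  by move=> z /= zr; apply: fc; exact: le_trans (ltW rs).
have Ocon : connected O.
  apply: outer_connected => // z u /set_mem/= zs /set_mem/= us; apply: finj;
    exact: dU.
have pI : I (f p) by exists p => //=; rewrite subrr cabs0 ltW.
have pO : O (f (p + s%:C%C)).
  have ps : cabs (p + s%:C%C - p) = s by rewrite addrC addKr cabs_real
    gtr0_norm.
  move=> [u /= us /finj E]; have uE : u = p + s%:C%C.
    by apply: E; apply: dU; [exact: ltW|rewrite ps].
  by move: us; rewrite uE ps ltxx.
have compE : components (~` A) = [set I; O].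
  by rewrite AE; apply: two_components => //;
    [exists (f p)|exists (f (p + s%:C%C))].
split=> //; last by move=> z Iz; rewrite AE; exact: component_left.
have inv w : exists u, (f @` U) w -> U u /\ f u = w.
  by have [[u Uu fu]|nw] := pselect ((f @` U) w); [exists u|exists 0].
have [g gP] := choice inv.
have gK u : U u -> g (f u) = u.
  by move=> Uu; have [Ug fg] := gP (f u) (ex_intro2 _ _ u Uu erefl);
    exact: finj.
split.
  split.
  - pose m := (r + s) / 2.
    exists (f (p + m%:C%C)); exists (p + m%:C%C) => //.
    rewrite /round_annulus/= cdistE addrC addKr cabs_real gtr0_norm /m;
      last by lra.
    by apply/andP; split; lra.
  - by apply: (univalent_image_open Uo fd fi AU); exact: round_annulus_open.
  - apply: connected_image; first exact: round_annulus_connected.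
    by move=> z /AU/fd/cdiff_cont.
  - rewrite compE; apply: card_set2 => E; suff : (set0 : set R[i]) (f p) by [].
    by rewrite -IO; split => //; rewrite -E.
exists p, r, s, g; split => //; first by rewrite r0.
- split; first by move=> _ [z /AU Uz <-];
  apply/derivableE/(inverse_cdiff Uo fd fi gK).
  by move=> _ _ /set_mem[z /AU Uz <-] /set_mem[u /AU Uu <-];
    rewrite !gK// => ->.
- rewrite eqEsubset; split=> [_ [_ [z Az <-] <-]|z Az]; first by rewrite gK//;
  exact: AU.
  by exists (f z); [exists z|rewrite gK//; exact: AU].
Qed.

End PlaneTopology.

(** * The limit set and its coding by infinite words *)

Section LimitSet.
Context {R : realType} {U X : set R[i]}.
Variable Phi : nifs U X.
Implicit Types (z w x y : R[i]).

Lemma X_neq0 : X !=set0.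
Proof.
have [[u Uu] _ _] := nifs_dom Phi; have [a] := nifs_idx Phi 0%N.
by exists (nmap a u); exact: nifs_maps.
Qed.

Lemma word_map_X k (v : word Phi k) z : X z -> X (word_map v z).
Proof.
elim: k v z => [|k IH] //= v z Xz.
by apply: IH; apply: nifs_maps; exact: (nifs_sub Phi).
Qed.

Definition piece k (v : word Phi k) : set R[i] := word_map v @` X.

Lemma piece_rcons k (v : word Phi k) (a : idx Phi k) :
  piece (k := k.+1) (v, a) = word_map v @` (nmap a @` X).
Proof. by rewrite /piece -image_comp. Qed.

Lemma pieceS k (v : word Phi k) (a : idx Phi k) :
  piece (k := k.+1) (v, a) `<=` piece v.
Proof.
rewrite piece_rcons => _ [_ [x Xx <-] <-]; exists (nmap a x) => //.
by apply: nifs_maps; exact: (nifs_sub Phi).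
Qed.

Lemma piece_prefix_le omega m n : (m <= n)%N ->
  piece (word_prefix (Phi := Phi) omega n) `<=` piece (word_prefix omega m).
Proof.
move=> /subnK <-; elim: (n - m)%N => [|k IH] //.
by rewrite addSn; apply: subset_trans IH; exact: pieceS.
Qed.

Section Conformal.
Hypothesis conf : conformal_nifs Phi.

Lemma nmap_cdiff j (a : idx Phi j) z : U z -> cdiff (nmap a) z.
Proof. by move=> Uz; apply/derivableE; have [an _] := conf a; exact: an. Qed.

Lemma nmap_inj j (a : idx Phi j) z w : U z -> U w -> nmap a z = nmap a w ->
  z = w.
Proof.
by move=> Uz Uw E; have [_ inj] := conf a;
  exact: inj (mem_set Uz) (mem_set Uw) E.
Qed.

Lemma word_map_cdiff k (v : word Phi k) z : U z -> cdiff (word_map v) z.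
Proof.
elim: k v z => [|k IH] v z Uz /=; first exact: cdiff_id.
apply: cdiff_comp; first exact: nmap_cdiff.
by apply: IH; apply: (nifs_sub Phi); exact: nifs_maps.
Qed.

Lemma word_map_inj k (v : word Phi k) z w : U z -> U w ->
  word_map v z = word_map v w -> z = w.
Proof.
elim: k v z w => [|k IH] v z w Uz Uw //= E.
apply: (@nmap_inj k v.2) => //.
by apply: IH E; apply: (nifs_sub Phi); exact: nifs_maps.
Qed.

Lemma piece_compact k (v : word Phi k) : compact (piece v).
Proof.
apply: compact_image; first exact: nifs_compact Phi.
by move=> z Xz; apply/cdiff_cont/word_map_cdiff; exact: (nifs_sub Phi).
Qed.

(** By separation at each level and injectivity of the word maps, a point
    determines the finite words whose pieces contain it. *)
Lemma piece_unique k (v v' : word Phi k) z : strong_separation Phi ->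
  piece v z -> piece v' z -> v = v'.
Proof.
move=> ssc; elim: k v v' => [[] [] //|k IH [v a] [v' a'] vz vz'].
have E := IH _ _ (pieceS vz) (pieceS vz'); subst v'; congr (_, _).
move: vz vz'; rewrite !piece_rcons => -[w aw wz] [w' aw' wz'].
have XU : forall b : idx Phi k, nmap b @` X `<=` U.
  move=> b _ [x Xx <-]; apply: (nifs_sub Phi).
  by apply: nifs_maps; exact: (nifs_sub Phi).
have ww : w = w' by apply: (@word_map_inj k v);
  [exact: XU aw|exact: XU aw'|rewrite wz'].
subst w'; apply: contrapT => aa'; suff : (set0 : set R[i]) w by [].
by rewrite -(ssc _ _ _ aa').
Qed.

(** The contraction metric is bounded on X: the balls of integer radius around a
    point are relatively open and exhaust the compact set X. *)
Lemma word_map_contract : exists (s D : R) (d : R[i] -> R[i] -> R),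
  [/\ 0 <= s < 1, forall k (v : word Phi k) x y, X x -> X y ->
        d (word_map v x) (word_map v y) <= s ^+ k * D
    & forall x y, X x -> X y -> d x y <= 0 -> x = y].
Proof.
have [s [d [/andP[s0 s1] [d0 deq dC dT] top contr]]] := nifs_contract Phi.
have XU := nifs_sub Phi.
have [x0 Xx0] := X_neq0.
pose V (n : nat) := [set y | X y /\ d x0 y < n%:R].
have [n nP] : exists n, X `&` ~` V n `<=` set0.
  have Vo n : exists2 O : set R[i], open O & V n = X `&` O.
    apply/(top (V n)); first by move=> y [].
    move=> z [Xz dz]; exists (n%:R - d x0 z); first by rewrite subr_gt0.
    move=> w Xw dw; split => //; apply: le_lt_trans (dT x0 z w _ _ _) _;
      try exact: XU.
    by move: dw; lra.
  apply: (@nested_compact_sub _ (fun n => X `&` ~` V n)) => //.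
  - move=> n; have [W Wo ->] := Vo n.
    have -> : X `&` ~` (X `&` W) = X `&` ~` W.
      by rewrite eqEsubset; split=> z [Xz nW]; split=> //; [move=> Wz;
        apply: nW|case].
    apply: compact_closedI; [exact: nifs_compact Phi|exact: open_closedC].
  - move=> n z [Xz nV]; split => // -[_ dz]; apply: nV; split => //.
    by apply: lt_le_trans dz _; rewrite ler_nat.
  - move=> z Vz; exfalso; have [Xz _] := Vz 0%N.
    have [_] := Vz (Num.bound (d x0 z)); apply; split => //.
    by apply: archi_boundP; apply: d0; exact: XU.
have dn y : X y -> d x0 y < n%:R.
  move=> Xy; apply: contrapT => ny; apply: (nP y); split => //.
  by move=> [].
exists s, (n%:R + n%:R), d; split.
- by rewrite s1 ltW.
- elim=> [|k IH] v x y Xx Xy /=.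
    rewrite expr0 mul1r; apply: le_trans (dT x x0 y _ _ _) _; try exact: XU.
    by rewrite (dC x x0) ?lerD ?ltW ?dn//; exact: XU.
  have S j (u : word Phi j) p q D : X p -> X q -> d p q <= D ->
      d (word_map u p) (word_map u q) <= s ^+ j * D.
    elim: j u p q D => [|j IHj] u p q D Xp Xq pqD; first by rewrite expr0 mul1r.
    rewrite /= exprSr -mulrA; apply: IHj; try by apply: nifs_maps; exact: XU.
    by apply: le_trans (contr _ _ _ _ Xp Xq) _; rewrite ler_wpM2l// ltW.
  rewrite exprSr -mulrA; apply: S; try by apply: nifs_maps; exact: XU.
  apply: le_trans (contr _ _ _ _ Xx Xy) _; rewrite ler_wpM2l ?ltW//.
  apply: le_lt_trans (dT x x0 y _ _ _) _; try exact: XU.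
  by rewrite (dC x x0) ?ltrD ?dn//; exact: XU.
- move=> x y Xx Xy dxy; apply/(deq x y (XU _ Xx) (XU _ Xy)).
  by apply/eqP; rewrite eq_le dxy d0//; exact: XU.
Qed.

(** Two points of all the pieces are at d-distance at most s ^+ n * D for all n. *)
Lemma coded_point_unique omega x y :
  (forall n, piece (word_prefix (Phi := Phi) omega n) x) ->
  (forall n, piece (word_prefix (Phi := Phi) omega n) y) -> x = y.
Proof.
move=> px py; have [s [D [d [/andP[s0 s1] dS d0]]]] := word_map_contract.
have X0 z : (forall n, piece (word_prefix (Phi := Phi) omega n) z) -> X z.
  by move=> /(_ 0%N)[w Xw <-].
apply: d0; [exact: X0|exact: X0|].
rewrite leNgt; apply/negP => dxy.
have bound n : d x y <= s ^+ n * D.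
  by have [[x' Xx' <-] [y' Xy' <-]] := (px n, py n); exact: dS.
have D0 : 0 < D by have := bound 0%N; rewrite expr0 mul1r; exact: lt_le_trans.
have sn1 : `|s| < 1 by rewrite ger0_norm.
have /cvgrPdist_lt/(_ (d x y / D)) := cvg_expr sn1.
rewrite divr_gt0// => /(_ isT)[n _ /(_ n (leqnn n))].
rewrite sub0r normrN ger0_norm ?exprn_ge0// ltr_pdivlMr// ltNge.
by rewrite bound.
Qed.

Lemma coded_point_exists omega :
  exists z, forall n, piece (word_prefix (Phi := Phi) omega n) z.
Proof.
apply: nested_compact.
- by move=> n; exact: piece_compact.
- by move=> n; have [x Xx] := X_neq0;
  exists (word_map (word_prefix omega n) x), x.
- by move=> n; exact: pieceS.
Qed.

Lemma projectionP omega z : projection Phi omega = z <->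
  forall n, piece (word_prefix (Phi := Phi) omega n) z.
Proof.
have [c cP] := coded_point_exists omega.
have all_n x : (\bigcap_(n in [set n | (0 < n)%N])
    (word_map (word_prefix (Phi := Phi) omega n) @` X)) x <->
    forall n, piece (word_prefix (Phi := Phi) omega n) x.
  split=> [H n|H n _]; last exact: H.
  by apply: (@piece_prefix_le omega n n.+1) => //; exact: H.
have pc : projection Phi omega = c.
  have /getPex E : exists y, [set y | \bigcap_(n in [set n | (0 < n)%N])
      (word_map (word_prefix (Phi := Phi) omega n) @` X) = [set y]] y.
    exists c; rewrite /= eqEsubset; split=> [y /all_n yP|_ ->];
      last exact/all_n.
    exact: (coded_point_unique yP cP).
  apply: (coded_point_unique (omega := omega)) => //; apply/all_n.
  by rewrite [X in X _]E.
by rewrite pc; split=> [<-//|zP]; exact: (coded_point_unique cP zP).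
Qed.

(** Compactness alone turns the intersection being a point into smallness for
    the Euclidean distance. *)
Lemma piece_shrinks omega (e : R) : 0 < e -> exists N, forall n, (N <= n)%N ->
  piece (word_prefix (Phi := Phi) omega n) `<=`
    [set z | cabs (z - projection Phi omega) < e].
Proof.
move=> e0; have [||||N NP] := @nested_compact_sub _
  (fun n => piece (word_prefix (Phi := Phi) omega n))
  [set z | cabs (z - projection Phi omega) < e].
- by move=> n; exact: piece_compact.
- by move=> n; exact: pieceS.
- exact: disc_open.
- by move=> z /projectionP -> /=; rewrite subrr cabs0.
by exists N => n Nn; apply: subset_trans NP; exact: piece_prefix_le.
Qed.

(** The words of the pieces that contain z are unique, hence are the prefixes of
    one infinite word. *)
Lemma limit_set_projection : strong_separation Phi ->
  limit_set Phi = range (projection Phi).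
Proof.
move=> ssc; rewrite eqEsubset; split=> [z zJ|_ [omega _ <-] k _]; last first.
  exists (word_prefix omega k) => //.
  by have /projectionP/(_ k) := erefl (projection Phi omega).
have wk k : exists v : word Phi k.+1, piece v z.
  by have [v _ vz] := zJ k.+1 isT; exists v.
pose W k := projT1 (cid (wk k)).
have WP k : piece (W k) z by rewrite /W; case: cid.
pose omega : infinite_word Phi := fun j => (W j).2.
exists omega => //; apply/projectionP.
have E n : word_prefix omega n.+1 = W n.
  elim: n => [|n IH].
    by rewrite /= /omega; case: (W 0%N) => -[].
  transitivity ((W n, (W n.+1).2) : word Phi n.+2); first by rewrite -IH.
  rewrite [RHS]surjective_pairing; congr (_, _).
  apply: (piece_unique ssc (WP n)); apply: (@pieceS _ _ (W n.+1).2).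
  by rewrite -surjective_pairing.
case=> [|n]; last by rewrite E.
by apply: (@piece_prefix_le omega 0 1) => //; rewrite E.
Qed.

Lemma limit_set_in_piece k (v : word Phi k) z : strong_separation Phi ->
  limit_set Phi z -> piece v z -> exists a : idx Phi k, piece (k := k.+1) (v,
    a) z.
Proof.
move=> ssc zJ vz; have [[v' a] _ v'z] := zJ k.+1 isT.
have E := piece_unique ssc vz (pieceS v'z); subst v'.
by exists a.
Qed.

Lemma eq_word_prefix (omega omega' : infinite_word Phi) k :
  (forall j, (j < k)%N -> omega j = omega' j) ->
  word_prefix omega k = word_prefix omega' k.
Proof.
elim: k => [|k IH] //= E; rewrite E// IH// => j jk; apply: E.
exact: ltnW.
Qed.

(** Replacing the letter of omega at position k by b gives another coded point. *)
Lemma limit_set_meets_piece (omega : infinite_word Phi) k (b : idx Phi k) :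
  strong_separation Phi ->
  exists2 z, limit_set Phi z & piece (k := k.+1) (word_prefix omega k, b) z.
Proof.
move=> ssc; pose omega' : infinite_word Phi := @dfwith _ (idx Phi) omega k b.
exists (projection Phi omega'); first by rewrite limit_set_projection//;
  exists omega'.
have /projectionP/(_ k.+1) := erefl (projection Phi omega').
rewrite /= (_ : omega' k = b); last exact: dfwithin.
rewrite (@eq_word_prefix omega' omega)// => j jk.
by apply: dfwithout; rewrite eq_sym neq_ltn jk.
Qed.

End Conformal.

End LimitSet.

(** * Distances and diameters *)

Section Diameters.
Context {R : realType}.
Implicit Types (A B X : set R[i]) (z w p : R[i]) (r M : R).

Lemma inf_cdist_le A B z w : A z -> B w -> dist A B <= cdist z w.
Proof.
move=> Az Bw; apply: ge_inf; last by exists z => //; exists w.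
by exists 0 => _ [x _ [y _ <-]]; exact: cabs_ge0.
Qed.

Lemma dist_ge0 A B : 0 <= dist A B.
Proof.
rewrite /dist; set S := (X in inf X); have [->|/set0P S0] := eqVneq S set0.
  by rewrite inf0.
by apply: lb_le_inf => // _ [x _ [y _ <-]]; exact: cabs_ge0.
Qed.

Lemma diam_le A M : (forall z w, A z -> A w -> cdist z w <= M) ->
  (diam A <= M%:E)%E.
Proof.
by move=> AM; apply: ge_ereal_sup => _ [z Az [w Aw <-]]; rewrite lee_fin AM.
Qed.

Lemma diam_ge A z w : A z -> A w -> ((cdist z w)%:E <= diam A)%E.
Proof. by move=> Az Aw; apply: ereal_sup_ubound; exists z => //; exists w. Qed.

Lemma diam_fin A M : A !=set0 -> (forall z w, A z -> A w -> cdist z w <= M) ->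
  diam A \is a fin_num.
Proof.
move=> [z Az] /diam_le AM; rewrite fin_numElt; apply/andP; split.
  by apply: lt_le_trans (diam_ge Az Az); rewrite ltNyr.
by apply: le_lt_trans AM _; rewrite ltry.
Qed.

Lemma diam_cvg0 (A : nat -> set R[i]) p : (forall n, A n !=set0) ->
  (forall e : R, 0 < e -> exists N, forall n, (N <= n)%N ->
     A n `<=` [set z | cabs (z - p) < e]) ->
  (fun n => diam (A n)) @ \oo --> 0%E.
Proof.
move=> A0 Ap.
have near_le (e : R) : 0 < e -> exists N, forall n, (N <= n)%N ->
    forall z w, A n z -> A n w -> cdist z w <= e.
  move=> e0; have [|N NP] := Ap (e / 2); first by rewrite divr_gt0.
  exists N => n /NP An z w /An/= zp /An/= wp; rewrite cdistE.
  by apply: le_trans (cabs_triangle p _ _) _; rewrite (cabsC p); lra.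
apply/fine_cvgP; split.
  have [N NP] := near_le 1 ltr01; exists N => // n /= Nn.
  exact: diam_fin (A0 n) (NP n Nn).
apply/cvgrPdist_le => e e0; have [N NP] := near_le e e0; exists N => // n /= Nn.
have fin := diam_fin (A0 n) (NP n Nn); have [z Az] := A0 n.
have d0 : 0 <= fine (diam (A n)).
  apply: fine_ge0; apply: le_trans (diam_ge Az Az).
  by rewrite lee_fin; exact: cabs_ge0.
by rewrite sub0r normrN ger0_norm// -lee_fin fineK// diam_le//; exact: NP.
Qed.

(** The disc is connected and does not meet the boundary of X, so its
    intersection with X is open and closed in it. *)
Lemma disc_sub_of_boundary X p r : closed X -> X p ->
  (forall q, boundary X q -> r < cabs (q - p)) ->
  [set z | cabs (z - p) <= r] `<=` X.
Proof.
move=> Xcl Xp Xb; have [r0|r0] := ltP r 0.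
  by move=> z /= zr; have := cabs_ge0 (z - p);
    rewrite leNgt (le_lt_trans zr r0).
set D := [set z | _].
have DE : D `&` X = D `&` interior X.
  rewrite eqEsubset; split=> z [Dz Xz]; split => //;
    last exact: interior_subset.
  apply: contrapT => nX; have zb : boundary X z.
    by split => //; exact: subset_closure.
  by have := Xb z zb; rewrite ltNge (Dz : cabs (z - p) <= r).
have <- : D `&` X = D; last by move=> z [].
apply: (closed_disc_connected (p := p) (r := r)).
- by exists p; split => //; rewrite /D/= subrr cabs0.
- by exists (interior X); [exact: open_interior|].
- by exists X.
Qed.

End Diameters.

(** * Annuli that separate the limit set *)

Section AnnulusAtOneLevel.
Context {R : realType} {U X : set R[i]}.
Variable Phi : nifs U X.
Hypotheses (conf : conformal_nifs Phi) (ssc : strong_separation Phi).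
Implicit Types (z w x y : R[i]).

Let XU := nifs_sub Phi.
Let Xcpt := nifs_compact Phi.

Lemma image_subX j (a : idx Phi j) : nmap a @` X `<=` X.
Proof. by move=> _ [x /XU Ux <-]; exact: nifs_maps. Qed.

Lemma X_bounded : exists2 D : R, 0 < D & forall z w, X z -> X w ->
  cdist z w <= D.
Proof.
have [M M0 MP] := compact_bound Xcpt.
exists (M + M); first by rewrite addr_gt0.
move=> z w Xz Xw; rewrite cdistE; apply: le_trans (cabsD _ _) _.
by rewrite cabsN lerD// MP.
Qed.

Lemma cdist_le_maxdiam j (a : idx Phi j) x y :
  (nmap a @` X) x -> (nmap a @` X) y -> cdist x y <= maxdiam Phi j.
Proof.
have [D D0 DP] := X_bounded.
have Dim (b : idx Phi j) z w : (nmap b @` X) z -> (nmap b @` X) w ->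
  cdist z w <= D.
  by move=> /image_subX Xz /image_subX Xw; exact: DP.
have fin (b : idx Phi j) : diam (nmap b @` X) \is a fin_num.
  have [x0 Xx0] := X_neq0 Phi.
  by apply: diam_fin (Dim b); exists (nmap b x0), x0.
move=> ax ay; apply: (@le_trans _ _ (fine (diam (nmap a @` X)))).
  by rewrite -lee_fin fineK//; exact: diam_ge.
apply: ub_le_sup; last by exists a.
by exists D => _ [b _ <-]; rewrite -lee_fin fineK//; exact/diam_le/Dim.
Qed.

(** The values of a non-constant map are two points of X, and injective maps
    keep them apart. *)
Lemma maxdiam_gt0 j : 0 < maxdiam Phi j.
Proof.
have [a] := nifs_idx Phi j.
have [z [w [Uz Uw azw]]] := nifs_nonconstant a.
have Xz := nifs_maps a Uz; have Xw := nifs_maps a Uw.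
apply: (@lt_le_trans _ _ (cdist (nmap a (nmap a z)) (nmap a (nmap a w)))).
  rewrite cdistE cabs_gt0 subr_eq0; apply/eqP => /(nmap_inj conf) E.
  by apply: azw; apply: E; exact: XU.
by apply: (@cdist_le_maxdiam j a); [exists (nmap a z)|exists (nmap a w)].
Qed.

Lemma gap_le_cdist j (a b : idx Phi j) x y : a <> b ->
  (nmap a @` X) x -> (nmap b @` X) y -> gap Phi j <= cdist x y.
Proof.
move=> ab ax bY; apply: (@le_trans _ _ (dist (nmap a @` X) (nmap b @` X))).
  apply: ge_inf; last by exists a, b.
  by exists 0 => _ [a' [b' [_ ->]]]; exact: dist_ge0.
exact: inf_cdist_le.
Qed.

Lemma bdist_le_cdist j (a : idx Phi j) x q : (nmap a @` X) x -> boundary X q ->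
  bdist Phi j <= cdist x q.
Proof.
move=> ax Xq; apply: (@le_trans _ _ (dist (nmap a @` X) (boundary X))).
  apply: ge_inf; last by exists a.
  by exists 0 => _ [b _ <-]; exact: dist_ge0.
exact: inf_cdist_le.
Qed.

(** The annulus of one level.  The last clause says that a point outside the
    piece lies in the outer component: it serves to separate subsets of the limit
    set that contain z and such a point. *)
Lemma separating_annulus (omega : infinite_word Phi) j (b : idx Phi j) (c : R) :
  1 < c -> gap Phi j <= c * bdist Phi j -> 2 * c * maxdiam Phi j < gap Phi j ->
  omega j <> b ->
  let z := projection Phi omega in
  let P := piece (word_prefix omega j) in
  exists A, [/\ has_modulus A (ln (gap Phi j / maxdiam Phi j / (2 * c))),
    separates A (limit_set Phi), A !=set0 /\ A `<=` P,
    (~` A) z /\ connected_component (~` A) z `<=` P &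
    forall K w, components (~` A) K -> ~ P w -> K z \/ K w].
Proof.
move=> c1 gb dg ab z P; set a := omega j in ab;
  set v := word_prefix omega j in P *.
(* half of gap / c, so that the closed disc of radius s misses the boundary *)
pose r := maxdiam Phi j; pose s := gap Phi j / (2 * c).
have c0 : 0 < c by lra.
have r0 : 0 < r by exact: maxdiam_gt0.
have c20 : 0 < 2 * c by lra.
have rs : r < s by rewrite /s ltr_pdivlMr// mulrC.
have s0 : 0 < s := lt_trans r0 rs.
have gE : gap Phi j = 2 * c * s by rewrite /s mulrC divfK// gt_eqF.
have sg : s < gap Phi j by rewrite gE -[X in X < _]mul1r ltr_pM2r//; lra.
have sb : s < bdist Phi j.
  rewrite -(ltr_pM2l c0); apply: lt_le_trans gb.
  by rewrite gE ltr_pM2r//; lra.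
have zP := (projectionP conf omega z).1 erefl.
have [x ax xz] : (word_map v @` (nmap a @` X)) z.
  by rewrite -piece_rcons; exact: zP j.+1.
have Xx := image_subX ax.
have discX y : cabs (y - x) <= s -> X y.
  apply: (disc_sub_of_boundary (compact_closedC Xcpt) Xx) => q Xq.
  by rewrite cabsC; apply: lt_le_trans sb (bdist_le_cdist ax Xq).
pose f := word_map v.
have fU y : U y -> cdiff f y by exact: word_map_cdiff.
have finj y w : U y -> U w -> f y = f w -> y = w by exact: word_map_inj.
have finj' : set_inj U f by move=> y w /set_mem Uy /set_mem Uw; exact: finj.
have [_ Uo _] := nifs_dom Phi.
have [mod comps compI] := univalent_annulus Uo fU finj' r0 rs
  (fun y ys => XU (discX y ys)).
set A := f @` round_annulus x r s in mod comps compI.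
set I := f @` _ in comps compI; set O := ~` _ in comps.
have AX y : round_annulus x r s y -> X y by move=> /andP[_ /ltW /discX].
have zI : I z by exists x; rewrite //= subrr cabs0 ltW.
have zJ : limit_set Phi z by rewrite limit_set_projection//; exists omega.
have IP : I `<=` P.
  by move=> _ [y /= yr <-]; exists y => //; apply: discX;
    exact: le_trans (ltW rs).
have compz := compI _ zI.
exists A; split.
- by rewrite (_ : _ / (2 * c) = s / r)// /s -/r; field; rewrite !gt_eqF.
- split.
    rewrite -subset0 => y [yJ [u ur uy]].
    have Py : piece v y by exists u => //; exact: AX.
    have [a'] := limit_set_in_piece conf ssc yJ Py.
    rewrite piece_rcons => -[u' au' uy'].
    have uu' : u' = u.
      by apply: finj; [exact/XU/(image_subX au')|exact/XU/AX|exact: etrans uy'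
        (esym uy)].
    subst u'; move: ur; rewrite /round_annulus/= => /andP[ru us].
    have [aa|aa] := pselect (a = a'); last first.
      have := gap_le_cdist aa ax au'; rewrite cdistE cabsC leNgt => /negP;
        apply.
      exact: lt_trans us sg.
    subst a'; have := cdist_le_maxdiam au' ax.
    by rewrite leNgt ru.
  rewrite comps => K [->|->]; first by exists z.
  have [y yJ yb] := limit_set_meets_piece conf omega b ssc.
  exists y; split => //; move: yb;
    rewrite piece_rcons => -[u bu uy] [u' /= us u'y].
  have uu' : u' = u.
    by apply: finj; [exact/XU/discX/ltW|exact/XU/(image_subX bu)|exact: etrans
      u'y (esym uy)].
  subst u'; have := gap_le_cdist ab ax bu; rewrite cdistE cabsC leNgt => /negP.
  by apply; exact: lt_trans us sg.
- split; last by move=> _ [y /AX Xy <-]; exists y.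
  by have [[]] := mod.
- split; last by rewrite compz.
  move=> [y yA yz]; suff yx : y = x.
    by move: yA; rewrite /round_annulus/= yx cdistE subrr cabs0 ltNge (ltW r0).
  by apply: finj; [exact/XU/AX|exact: XU|exact: etrans yz (esym xz)].
- rewrite comps => K w [->|->] nP; first by left.
  by right => -[y /= ys yw]; apply: nP; exists y => //; apply: discX;
    exact: ltW.
Qed.

(** The annuli of the levels jn n, from the first n on for which their inner
    radius is less than their outer radius. *)
Lemma thin_annuli (jn : nat -> nat) (c : R) : {homo jn : m n / (m < n)%N} ->
  (forall n, exists N : nat, (2 <= N)%N /\ ([set: idx Phi (jn n)] #=
    `I_N)%card) ->
  1 < c -> (forall n, gap Phi (jn n) <= c * bdist Phi (jn n)) ->
  (fun n => gap Phi (jn n) / maxdiam Phi (jn n)) @ \oo --> +oo ->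
  forall z, limit_set Phi z -> exists (A P : nat -> set R[i]) (m : nat -> R),
  [/\ forall n, has_modulus (A n) (m n) /\ separates (A n) (limit_set Phi),
      forall n, [/\ (~` A n) z, connected_component (~` A n) z `<=` P n,
        A n !=set0, A n `<=` P n & P n `<=` X],
      forall n K w, components (~` A n) K -> ~ P n w -> K z \/ K w,
      m @ \oo --> +oo &
      forall e : R, 0 < e -> exists N, forall n, (N <= n)%N ->
        P n `<=` [set w | cabs (w - z) < e]].
Proof.
move=> jn_incr card_jn c1 gb ratio y yJ.
have [omega _ <-] : range (projection Phi) y by rewrite -limit_set_projection.
have c20 : 0 < 2 * c by lra.
have other n : exists b : idx Phi (jn n), omega (jn n) <> b.
  apply: contrapT => /forallNP H; have [N [N2 NE]] := card_jn n.
  have E : [set: idx Phi (jn n)] = [set omega (jn n)].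
    by rewrite eqEsubset; split=> // b _; apply: esym; apply: contrapT;
      exact: H.
  move: NE; rewrite E (card_eql card_set1) => /card_eq_II N1.
  by rewrite -N1 in N2.
have ratioP M : exists N, forall n, (N <= n)%N ->
    M <= gap Phi (jn n) / maxdiam Phi (jn n).
  by have /cvgryPge/(_ M)[N _ NP] := ratio; exists N => n Nn; exact: NP.
have [n0 n0P] := ratioP (2 * c + 1).
pose k n := jn (n + n0)%N; pose P n := piece (word_prefix omega (k n)).
pose z := projection Phi omega.
have step n : exists A, [/\ has_modulus A (ln (gap Phi (k n) /
  maxdiam Phi (k n) / (2 * c))),
    separates A (limit_set Phi), A !=set0 /\ A `<=` P n,
    (~` A) z /\ connected_component (~` A) z `<=` P n &
    forall K w, components (~` A) K -> ~ P n w -> K z \/ K w].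
  have [b ab] := other (n + n0)%N; apply: (separating_annulus c1 (gb _) _ ab).
  have := n0P (n + n0)%N (leq_addl _ _); rewrite ler_pdivlMr ?maxdiam_gt0//.
  by move=> H; apply: lt_le_trans H; rewrite ltr_pM2r ?maxdiam_gt0//; lra.
have [A AP] := choice step.
exists A, P, (fun n => ln (gap Phi (k n) / maxdiam Phi (k n) / (2 * c))); split.
- by move=> n; have [? ? _ _ _] := AP n.
- move=> n; have [_ _ [A0 AsP] [zA CP] _] := AP n; split => //.
  by move=> _ [x Xx <-]; exact: word_map_X.
- by move=> n K w; have [_ _ _ _ dich] := AP n; exact: dich.
- apply/cvgryPge => M; have [N NP] := ratioP (2 * c * expR M);
  exists N => // n /= Nn.
  have := NP (n + n0)%N (leq_trans Nn (leq_addr _ _)); rewrite -/(k n).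
  rewrite -ler_pdivlMl// [X in _ <= X]mulrC => H.
  by rewrite -[M]expRK ler_ln ?posrE ?expR_gt0// (lt_le_trans _ H) ?expR_gt0.
- move=> e e0; have [N NP] := piece_shrinks conf omega e0; exists N => n Nn.
  apply: NP; apply: leq_trans Nn _; apply: (@leq_trans (n + n0)%N);
    first exact: leq_addr.
  have jn_ge i : (i <= jn i)%N.
    by elim: i => [|i IH] //; apply: leq_ltn_trans IH _; exact: jn_incr.
  exact: jn_ge.
Qed.

End AnnulusAtOneLevel.

Theorem corollary1p1 (R : realType) (U X : set R[i]) (Phi : nifs U X)
    (conf : conformal_nifs Phi) (Xconn : connected X)
    (ssc : strong_separation Phi)
    (jn : nat -> nat) (jn_incr : {homo jn : m n / (m < n)%N})
    (card_jn : forall n, exists N : nat,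
       (2 <= N)%N /\ ([set: idx Phi (jn n)] #= `I_N)%card)
    (c : R) (c_gt1 : 1 < c)
    (gap_le : forall n, gap Phi (jn n) <= c * bdist Phi (jn n))
    (gap_ratio :
       (fun n => gap Phi (jn n) / maxdiam Phi (jn n)) @ \oo --> +oo) :
  [/\ limit_set Phi = range (projection Phi),
      pointwise_thin (limit_set Phi)
    & compact (limit_set Phi) -> hnup (limit_set Phi)].
Proof.
have thin := thin_annuli conf ssc jn_incr card_jn c_gt1 gap_le gap_ratio.
split; first exact: limit_set_projection.
- move=> z /thin[A [P [m [Am AP _ mpinf Psmall]]]]; exists A, m; split => //.
  + move=> n; have [zA CP _ _ PX] := AP n; split => //.
    have [M M0 MP] := compact_bound (nifs_compact Phi).
    exists (M%:C%C); split; first by apply/complex_realP; exists M.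
    move=> x Mx w /CP/PX/MP wM /=; rewrite normE; apply: le_trans (ltW Mx).
    by rewrite lecR.
  + apply: (diam_cvg0 (p := z)) => [n|e /Psmall[N NP]];
    first by have [] := AP n.
    exists N => n Nn; apply: subset_trans (NP n Nn).
    by have [] := AP n.
- move=> Jcpt; split => // F FJ [_ [z [w [Fz Fw zw]]] [M MP]].
  have [A [P [m [Am AP dich mpinf Psmall]]]] := thin z (FJ _ Fz).
  have [N NP] : exists N, forall n, (N <= n)%N ->
      P n `<=` [set u | cabs (u - z) < cabs (w - z)].
    apply: Psmall; rewrite cabs_gt0 subr_eq0; apply/eqP => wz.
    exact: zw.
  have /cvgryPge/(_ (M + 1))[N' _ NP'] := mpinf.
  pose n := maxn N N'.
  have [mod [JA _]] := Am n.
  have : m n <= M.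
    apply: MP mod _; split.
      by rewrite -subset0 => u [/FJ uJ uA]; rewrite -JA.
    move=> K KA; have nPw : ~ P n w.
      by move=> /(NP n (leq_maxl _ _))/=; rewrite ltxx.
    by have [Kz|Kw] := dich n K w KA nPw; [exists z|exists w].
  have := NP' n (leq_maxr _ _); lra.
Qed.
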